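(* Let $S=\mathbb{K}[x_1,\dots,x_n]$ and let $I\subseteq S$ be a square-free monomial ideal which contains no variable. Assume that for some integer $s\geq 1$ the ideal $I^s$ has linear quotients with respect to (the restriction to $G(I^s)$ of) a monomial order. Then $S/I$ is a Golod ring.
   Context: $G(J)$ denotes the set of minimal monomial generators of a monomial ideal $J$. A monomial order is a multiplicative total order on monomials with $1$ least. If $u_1\prec\dots\prec u_t$ is a linear order on $G(J)$, $J$ has linear quotients with respect to it if for every $2\leq i\leq t$ the ideal $(u_1,\dots,u_{i-1}):u_i$ is generated by a subset of the variables. $S/I$ is Golod if all Massey operations on the Koszul complex of $S/I$ with respect to $x_1,\dots,x_n$ vanish; equivalently, equality holds in the coefficientwise inequality $\sum_{i\ge0}\dim_{\mathbb{K}}\operatorname{Tor}_i^{S/I}(\mathbb{K},\mathbb{K})t^i\le \frac{(1+t)^n}{1-t\sum_{i\ge1}\dim_{\mathbb{K}}\operatorname{Tor}_i^S(S/I,\mathbb{K})t^i}$. *)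

(* Defs.v *)
From HB Require Import structures.
From mathcomp Require Import all_boot all_order all_algebra.
From mathcomp Require Import mpoly.
Set Implicit Arguments.
Unset Strict Implicit.
Unset Printing Implicit Defensive.
Import GRing.Theory.
Local Open Scope ring_scope.

Section Defs.
Variable (K : fieldType) (n : nat).
Local Notation mon := 'X_{1..n}.
Local Notation S := {mpoly K[n]}.

Definition in_mon_ideal (P : mon -> Prop) (p : S) : Prop :=
  exists (vs : seq mon) (c : mon -> S),
    (forall v, v \in vs -> P v) /\ p = \sum_(v <- vs) c v * 'X_[v].

Definition squarefree (m : mon) : bool := [forall i, m i <= 1]%N.

Definition monomial_order (le : rel mon) : Prop :=
  [/\ reflexive le, antisymmetric le, transitive le & total le] /\
  (forall m1 m2 m, le m1 m2 -> le (m1 + m)%MM (m2 + m)%MM) /\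
  (forall m, le 0%MM m).

Definition pow_gen (gens : seq mon) (s : nat) (m : mon) : Prop :=
  exists t : seq mon, [/\ size t = s, all (mem gens) t & m = (\sum_(g <- t) g)%MM].

Definition min_gens (P : mon -> Prop) (u : mon) : Prop :=
  in_mon_ideal P 'X_[u] /\
  forall v : mon, in_mon_ideal P 'X_[v] -> (v <= u)%MM -> v = u.

Definition linear_quotients (G : mon -> Prop) (lt : mon -> mon -> Prop) :=
  forall u, G u -> (exists v, G v /\ lt v u) ->
    exists V : {set 'I_n}, forall p : S,
      in_mon_ideal (fun v => G v /\ lt v u) (p * 'X_[u]) <->
      in_mon_ideal (fun m => exists2 j, j \in V & m = U_(j)%MM) p.

(* ---------- Koszul complex of R = S/I, I = (gens) monomial ---------- *)
(* R has K-basis the monomials outside I; an element of the Koszul       *)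
(* complex K^R = R (x) /\(e_1..e_n) is stored as F |-> coefficient of e_F, *)
(* a polynomial reduced modulo I (no monomial of its support in I).      *)
Definition KR := {ffun {set 'I_n} -> S}.

Definition inI (gens : seq mon) (m : mon) : bool := has (fun g => g <= m)%MM gens.

Definition redI (gens : seq mon) (p : S) : S :=
  \sum_(m <- msupp p | ~~ inI gens m) p@_m *: 'X_[m].
Definition reduce (gens : seq mon) (a : KR) : KR := [ffun F : {set 'I_n} => redI gens (a F)].
Definition reduced gens (a : KR) : Prop := reduce gens a = a.

Definition khomog (k : nat) (a : KR) : Prop := forall F : {set 'I_n}, #|F| <> k -> a F = 0.

(* e_F /\ e_G = (-1)^(inv F G) e_(F u G) for disjoint F, G *)
Definition kinv (F G : {set 'I_n}) : nat := #|[set p in setX F G | (p.2 < p.1)%N]|.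

Definition kmul gens (a b : KR) : KR := reduce gens [ffun H : {set 'I_n} =>
  \sum_(F : {set 'I_n}) \sum_(G : {set 'I_n} | [disjoint F & G] && (F :|: G == H))
     (-1) ^+ kinv F G * (a F * b G)].

(* Koszul differential: d(f e_F) = sum_(i in F) (-1)^#{j in F | j < i} x_i f e_(F\i) *)
Definition kdiff gens (a : KR) : KR := reduce gens [ffun H : {set 'I_n} =>
  \sum_(i : 'I_n | i \notin H)
     (-1) ^+ #|[set j in H | (j < i)%N]| * ('X_i * a (i |: H))].

Definition kbar (a : KR) : KR := [ffun F : {set 'I_n} => (-1) ^+ (#|F|.+1) * a F].

Definition kcycle gens (a : KR) : Prop := reduced gens a /\ kdiff gens a = 0.
Definition kboundary gens (a : KR) : Prop := exists b, a = kdiff gens b.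

(* S/I is Golod: the Koszul complex admits a trivial Massey operation.   *)
(* z : 'I_m -> KR are homogeneous cycles (of degrees dz) whose classes   *)
(* form a K-basis of H_{>=1}(K^R); mu is defined on all nonempty finite  *)
(* sequences of basis elements.                                          *)
Definition Golod (gens : seq mon) : Prop :=
  exists (m : nat) (z : 'I_m -> KR) (dz : 'I_m -> nat) (mu : seq 'I_m -> KR),
  [/\ (forall k, kcycle gens (z k) /\ (1 <= dz k)%N /\ khomog (dz k) (z k)),
      (forall c : 'I_m -> K, kboundary gens (\sum_k c k *: z k) -> forall k, c k = 0),
      (forall a, kcycle gens a -> a set0 = 0 ->
         exists (c : 'I_m -> K) (b : KR), a = \sum_k c k *: z k + kdiff gens b)
    & (forall k, mu [:: k] = z k)] /\
  (forall s, (1 <= size s)%N ->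
         reduced gens (mu s) /\ khomog (\sum_(k <- s) dz k + size s - 1) (mu s)) /\
  (forall s, (2 <= size s)%N ->
         kdiff gens (mu s) =
         \sum_(1 <= j < size s) kmul gens (kbar (mu (take j s))) (mu (drop j s))).

End Defs.

(* Main.v *)
(* The hypothesis passes from I^s to I.  If u < v are minimal generators of I,  *)
(* then v^s is a minimal generator of I^s, and linear quotients give a          *)
(* generator w = t_1 ... t_s < v^s of I^s dividing x_j v^s, where x_j divides u *)
(* but not v.  As I is square-free, each t_i divides x_j v, and since the order *)
(* is monomial some t_i is smaller than v.  Hence I has linear quotients, and   *)
(* one may reorder its generators by increasing degree without losing them.     *)
(*   Give x^m e_F the coefficient degree |m|, and let I_j be generated by the   *)
(* generators of I of degree at most j.  By induction on the generators, the    *)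
(* Koszul homology of S/I_j vanishes in coefficient degrees >= max(1, j).  A    *)
(* homogeneous cycle of K(S/I) of coefficient degree e is already a cycle       *)
(* modulo I_(e+1), because its differential has coefficient degree e+1.  So for *)
(* basis cycles of coefficient degrees e_1, ..., e_r, all >= 1, the obstruction *)
(* to extending the Massey operation is a cycle modulo I_j, j = 1 + max e_i, of *)
(* coefficient degree e_1 + ... + e_r - (r - 2) >= j, and thus a boundary.      *)
Require Import Defs.
From HB Require Import structures.
From mathcomp Require Import all_boot all_order all_algebra.
From mathcomp Require Import mpoly ring zify.
From Stdlib Require Import Classical ClassicalEpsilon.
Set Implicit Arguments.
Unset Strict Implicit.
Unset Printing Implicit Defensive.
Import GRing.Theory.
Local Open Scope ring_scope.

(** * The Koszul complex of the polynomial ring *)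

Section Operators.
Variables (K : fieldType) (n : nat).
Local Notation S := {mpoly K[n]}.
Local Notation KR := (KR K n).
Implicit Types (a b : KR) (p : S) (i j l : 'I_n) (F G H : {set 'I_n}).

Definition nbelow i H := #|[set j in H | (j < i)%N]|.

Lemma nbelowE i H : nbelow i H = (\sum_(j in H) (j < i)%N)%N.
Proof.
by rewrite /nbelow -sum1dep_card [RHS]big_mkcond [LHS]big_mkcond; apply: eq_bigr => j _;
  case: (j \in H); case: ltnP.
Qed.

Lemma nbelowU1 i l H : l \notin H -> nbelow i (l |: H) = ((l < i) + nbelow i H)%N.
Proof. by move=> lH; rewrite !nbelowE big_setU1. Qed.

Lemma nbelowD1 i l H : l \in H -> nbelow i H = ((l < i) + nbelow i (H :\ l))%N.
Proof. by move=> lH; rewrite !nbelowE (big_setD1 l). Qed.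

Lemma kinvE F G : kinv F G = (\sum_(i in F) nbelow i G)%N.
Proof.
rewrite /kinv -sum1dep_card.
under [RHS]eq_bigr do rewrite nbelowE.
rewrite pair_big_dep /= [RHS]big_mkcond [LHS]big_mkcond /=.
by apply: eq_bigr => -[i j] _ /=; rewrite in_setX /=; case: (i \in F); case: (j \in G);
  case: (j < i)%N.
Qed.

Lemma kinvU1 i F G : i \notin F -> kinv (i |: F) G = (nbelow i G + kinv F G)%N.
Proof. by move=> iF; rewrite !kinvE big_setU1. Qed.

Definition smul p a : KR := [ffun F => p * a F].

(* [koszul] and [kprod] are not reduced modulo I: they live over S, whereas [kdiff] *)
(* and [kmul] live over S/I. *)
Definition koszul a : KR := [ffun H : {set 'I_n} =>
  \sum_(i : 'I_n | i \notin H) (-1) ^+ nbelow i H * ('X_i * a (i |: H))].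

Definition wedge i a : KR := [ffun H : {set 'I_n} =>
  if i \in H then (-1) ^+ nbelow i H * a (H :\ i) else 0].

Definition kprod a b : KR := [ffun H : {set 'I_n} =>
  \sum_(F : {set 'I_n}) \sum_(G : {set 'I_n} | [disjoint F & G] && (F :|: G == H))
     (-1) ^+ kinv F G * (a F * b G)].

Definition kbasis F : KR := [ffun G => (G == F)%:R].

Lemma kprodE a b H : kprod a b H =
  \sum_(F : {set 'I_n} | F \subset H) (-1) ^+ kinv F (H :\: F) * (a F * b (H :\: F)).
Proof.
rewrite ffunE [RHS]big_mkcond /=; apply: eq_bigr => F _.
case: ifP => [FH|/negP FH].
  rewrite (big_pred1 (H :\: F)) // => G.
  apply/andP/eqP => [[dFG /eqP <-]|->].
    by rewrite setDUl setDv set0U; apply/esym/setDidPl; rewrite disjoint_sym.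
  split; last by apply/eqP/setP => x; rewrite !inE;
    case: (boolP (x \in F)) => //= /(subsetP FH) ->.
  by rewrite -setI_eq0; apply/eqP/setP => x; rewrite !inE; case: (x \in F).
rewrite big_pred0 // => G; apply/negP => /andP[_ /eqP HE].
by apply: FH; rewrite -HE subsetUl.
Qed.

Fact koszul_is_additive : {morph koszul : a b / a - b}.
Proof.
move=> a b; apply/ffunP => H; rewrite !ffunE -sumrB; apply: eq_bigr => i _.
by rewrite !ffunE !mulrBr.
Qed.
HB.instance Definition _ := GRing.isZmodMorphism.Build KR KR koszul koszul_is_additive.

Lemma koszul_smul p a : koszul (smul p a) = smul p (koszul a).
Proof.
apply/ffunP => H; rewrite !ffunE mulr_sumr; apply: eq_bigr => i _.
by rewrite !ffunE [RHS]mulrCA; congr (_ * _); rewrite mulrCA.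
Qed.

Fact wedge_is_additive i : {morph wedge i : a b / a - b}.
Proof.
by move=> a b; apply/ffunP => H; rewrite !ffunE; case: ifP; rewrite ?subr0 // mulrBr.
Qed.
HB.instance Definition _ i := GRing.isZmodMorphism.Build KR KR (wedge i) (wedge_is_additive i).

Fact kprod_is_additive a : {morph kprod a : b c / b - c}.
Proof.
move=> b c; apply/ffunP => H; rewrite !ffunE -sumrB; apply: eq_bigr => F _.
by rewrite -sumrB; apply: eq_bigr => G _; rewrite !ffunE !mulrBr.
Qed.
HB.instance Definition _ a := GRing.isZmodMorphism.Build KR KR (kprod a) (kprod_is_additive a).

Fact kprodr_is_additive b : {morph kprod^~ b : a c / a - c}.
Proof.
move=> a c; apply/ffunP => H; rewrite !ffunE -sumrB; apply: eq_bigr => F _.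
by rewrite -sumrB; apply: eq_bigr => G _; rewrite !ffunE mulrBl !mulrBr.
Qed.
Definition kprodr b a := kprod a b.
HB.instance Definition _ b := GRing.isZmodMorphism.Build KR KR (kprodr b)
  (kprodr_is_additive b).

Lemma kprod0l b : kprod 0 b = 0. Proof. exact: (raddf0 (kprodr b)). Qed.
Lemma kprodNl a b : kprod (- a) b = - kprod a b. Proof. exact: (raddfN (kprodr b)). Qed.
Lemma kprodDl a c b : kprod (a + c) b = kprod a b + kprod c b.
Proof. exact: (raddfD (kprodr b)). Qed.
Lemma kprodBl a c b : kprod (a - c) b = kprod a b - kprod c b.
Proof. exact: (raddfB (kprodr b)). Qed.
Lemma kprod_suml (I : Type) (r : seq I) (P : pred I) (f : I -> KR) b :
  kprod (\sum_(x <- r | P x) f x) b = \sum_(x <- r | P x) kprod (f x) b.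
Proof. exact: (raddf_sum (kprodr b)). Qed.

Lemma kprodDr a b c : kprod a (b + c) = kprod a b + kprod a c.
Proof. exact: raddfD. Qed.

Lemma kprod_smull p a b : kprod (smul p a) b = smul p (kprod a b).
Proof.
apply/ffunP => H; rewrite !ffunE mulr_sumr; apply: eq_bigr => F _.
by rewrite mulr_sumr; apply: eq_bigr => G _; rewrite !ffunE -mulrA mulrCA.
Qed.

Fact kbar_is_additive : {morph @kbar K n : a b / a - b}.
Proof. by move=> a b; apply/ffunP => H; rewrite !ffunE mulrBr. Qed.
HB.instance Definition _ := GRing.isZmodMorphism.Build KR KR (@kbar K n) kbar_is_additive.

Lemma kbar_smul p a : kbar (smul p a) = smul p (kbar a).
Proof. by apply/ffunP => H; rewrite !ffunE mulrCA. Qed.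

Fact smul_is_additive p : {morph smul p : a b / a - b}.
Proof. by move=> a b; apply/ffunP => H; rewrite !ffunE mulrBr. Qed.
HB.instance Definition _ p := GRing.isZmodMorphism.Build KR KR (smul p) (smul_is_additive p).

Lemma scale_smul (c : K) a : c *: a = smul c%:MP a.
Proof. by apply/ffunP => H; rewrite !ffunE mul_mpolyC. Qed.

(* Checking identities only on wedges by one generator keeps the signs [kinv] out of *)
(* the proofs of the Leibniz rule and of associativity. *)
Lemma KR_ind (P : KR -> Prop) :
  P 0 -> (forall a b, P a -> P b -> P (a + b)) ->
  (forall p a, P a -> P (smul p a)) -> P (kbasis set0) ->
  (forall i a, P a -> P (wedge i a)) -> forall a, P a.
Proof.
move=> P0 PD PZ P1 PW a.
have -> : a = \sum_(F : {set 'I_n}) smul (a F) (kbasis F).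
  apply/ffunP => H; rewrite sum_ffunE (bigD1 H) //= !ffunE eqxx mulr1 big1 ?addr0 // => F FH.
  by rewrite !ffunE eq_sym (negPf FH) mulr0.
elim/big_ind: _ => // F _; apply: (PZ).
elim: {F}#|F| {-2}F (leqnn #|F|) => [|k IH] F Fk.
  by move: Fk; rewrite leqn0 cards_eq0 => /eqP ->.
have [->//|[i iF]] := set_0Vmem F.
have Fk' : (#|F :\ i| <= k)%N by move: Fk; rewrite (cardsD1 i) iF.
have -> : kbasis F = smul ((-1) ^+ nbelow i F) (wedge i (kbasis (F :\ i))).
  apply/ffunP => H; rewrite !ffunE; case: ifP => iH.
    case: (H =P F) => [->|HF]; first by rewrite eqxx mulr1 -exprMn mulN1r opprK expr1n.
    case: eqP => [HF'|]; last by rewrite !mulr0.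
    by case: HF; rewrite -(setD1K iH) HF' setD1K.
  by rewrite mulr0; case: eqP => // HF; rewrite HF iF in iH.
by apply/PZ/PW/IH.
Qed.

Lemma koszul_wedge i a : koszul (wedge i a) = smul 'X_i a - wedge i (koszul a).
Proof.
apply/ffunP => H; rewrite !ffunE; case: ifP => iH.
  have cH : nbelow i (H :\ i) = nbelow i H by rewrite [RHS](nbelowD1 i iH) ltnn.
  rewrite [X in _ - _ * X](bigD1 i) /=; last by rewrite !inE eqxx.
  rewrite setD1K // cH mulrDr mulrA -exprMn mulN1r opprK expr1n mul1r opprD addNKr.
  rewrite mulr_sumr -sumrN; apply: eq_big => [l|l lH].
    by rewrite !inE; case: eqP => [->|_] /=; rewrite ?iH ?andbF ?andbT.
  rewrite ffunE !inE iH orbT.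
  have li : l != i by apply: contra lH => /eqP ->.
  rewrite (nbelowU1 _ lH) (nbelowD1 l iH).
  have -> : (l |: H) :\ i = l |: H :\ i.
    by apply/setP => x; rewrite !inE; case: eqP => // ->; rewrite eq_sym (negPf li).
  (* Inserting l and removing i in the two possible orders gives opposite signs, because exactly one
     of i < l and l < i holds. *)
  have e : (-1) ^+ (i < l)%N * (-1) ^+ (l < i)%N = -1 :> S.
    by case: ltngtP => [_|_|/val_inj/esym/eqP]; rewrite ?mulr1 ?mul1r // (negPf li).
  rewrite !exprD; move: e; set x := _ ^+ (i < l)%N; set y := _ ^+ (l < i)%N.
  set u := _ ^+ nbelow l _; set v := _ ^+ nbelow i _ => e.
  by ring: e.
rewrite subr0 (bigD1 i) ?iH //= big1 ?addr0.
  by rewrite ffunE setU11 setU1K ?iH // nbelowU1 ?iH // ltnn add0n mulrCA signrMK.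
move=> l /andP[lH li]; rewrite ffunE !inE iH orbF eq_sym (negPf li).
by rewrite !mulr0.
Qed.

Lemma wedge_kprod i a b : kprod (wedge i a) b = wedge i (kprod a b).
Proof.
apply/ffunP => H; rewrite kprodE ffunE; case: ifP => iH; last first.
  rewrite big1 // => F FH; rewrite ffunE; case: ifP; rewrite ?mul0r ?mulr0 // => iF.
  by rewrite (subsetP FH _ iF) in iH.
rewrite kprodE mulr_sumr (bigID (fun F : {set 'I_n} => i \in F)) /= addrC big1 ?add0r;
  last first.
  by move=> F /andP[_ iF]; rewrite ffunE (negPf iF) mul0r mulr0.
rewrite (reindex_onto (fun F => i |: F) (fun F => F :\ i)) /=; last first.
  by move=> F /andP[_ iF]; rewrite setD1K.
apply: eq_big => [F|F].
  rewrite setU11 andbT subsetD1 subUset sub1set iH /=.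
  case: (boolP (i \in F)) => iF; last by rewrite setU1K ?eqxx // !andbT.
  by rewrite andbF; apply/negP => /andP[_ /eqP/setP/(_ i)]; rewrite !inE iF eqxx.
move=> /andP[/andP[FH _] /eqP FE]; have iF : i \notin F by rewrite -FE !inE eqxx.
rewrite ffunE setU11 FE kinvU1 //.
have -> : H :\: (i |: F) = H :\ i :\: F by rewrite setUC setDDl setUC.
rewrite nbelowU1 // ltnn add0n exprD.
have -> : nbelow i H = (nbelow i F + nbelow i (H :\ i :\: F))%N.
  rewrite (nbelowD1 i iH) ltnn add0n !nbelowE (big_setID F) /=; congr (_ + _)%N.
  by rewrite setIC (setIidPl _) // subsetD1 iF andbT; move: FH; rewrite subUset => /andP[].
rewrite exprD.
have := signrMK (nbelow i F) (1 : S); rewrite mulr1.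
set x := (-1) ^+ nbelow i F. set y := _ ^+ nbelow i _. set z := _ ^+ kinv _ _ => _.
ring.
Qed.

Lemma kbar_wedge i a : kbar (wedge i a) = - wedge i (kbar a).
Proof.
apply/ffunP => H; rewrite !ffunE; case: ifP => iH; last by rewrite mulr0 oppr0.
by rewrite (cardsD1 i H) iH add1n exprS mulN1r mulNr mulrCA.
Qed.

Lemma kprod1l b : kprod (kbasis set0) b = b.
Proof.
apply/ffunP => H; rewrite kprodE (bigD1 set0) ?sub0set //= big1 ?addr0.
  by rewrite kinvE big_set0 expr0 setD0 ffunE eqxx !mul1r.
by move=> F /andP[_ /negPf F0]; rewrite ffunE F0 mul0r mulr0.
Qed.

Lemma koszul1 : koszul (kbasis set0) = 0.
Proof.
apply/ffunP => H; rewrite !ffunE big1 // => i _; rewrite ffunE.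
by case: eqP => [/setP/(_ i)|_]; rewrite ?inE ?eqxx // !mulr0.
Qed.

Lemma kbar1 : kbar (kbasis set0) = - kbasis set0.
Proof.
apply/ffunP => H; rewrite !ffunE; case: eqP => [->|_]; last by rewrite mulr0 oppr0.
by rewrite cards0 expr1 mulr1.
Qed.

Lemma koszul_koszul a : koszul (koszul a) = 0.
Proof.
elim/KR_ind: a => [|a b ha hb|p a ha||i a ha].
- by rewrite !raddf0.
- by rewrite !raddfD /= ha hb addr0.
- by rewrite !koszul_smul ha; apply/ffunP => H; rewrite !ffunE mulr0.
- by rewrite koszul1 raddf0.
- by rewrite koszul_wedge raddfB /= koszul_smul koszul_wedge ha raddf0 subr0 subrr.
Qed.

Lemma kbarK a : kbar (kbar a) = a.
Proof. by apply/ffunP => H; rewrite !ffunE signrMK. Qed.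

Lemma koszul_kbar a : koszul (kbar a) = - kbar (koszul a).
Proof.
apply/ffunP => H; rewrite !ffunE mulr_sumr -sumrN; apply: eq_bigr => i iH.
rewrite ffunE cardsU1 iH add1n exprS mulN1r mulNr !mulrN.
by congr (- _); rewrite [RHS]mulrCA; congr (_ * _); rewrite mulrCA.
Qed.

Lemma kprodA a b c : kprod (kprod a b) c = kprod a (kprod b c).
Proof.
elim/KR_ind: a => [|a a' ha hb|p a ha||i a ha].
- by rewrite !kprod0l.
- by rewrite !kprodDl ha hb.
- by rewrite !kprod_smull ha.
- by rewrite !kprod1l.
- by rewrite !wedge_kprod ha.
Qed.

Lemma kbar_kprod a b : kbar (kprod a b) = - kprod (kbar a) (kbar b).
Proof.
elim/KR_ind: a => [|a a' ha hb|p a ha||i a ha].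
- by rewrite kprod0l !raddf0 kprod0l oppr0.
- by rewrite kprodDl !raddfD kprodDl /= ha hb opprD.
- by rewrite kprod_smull !kbar_smul kprod_smull ha raddfN.
- by rewrite kbar1 kprod1l kprodNl kprod1l opprK.
- by rewrite wedge_kprod !kbar_wedge ha raddfN /= kprodNl wedge_kprod.
Qed.

(** Since [kbar] carries the sign (-1)^(deg + 1), the Leibniz rule takes a minus here. By [KR_ind]
    it reduces to how [koszul], [kbar] and [kprod] pass through a single wedge. *)
Lemma koszul_kprod a b : koszul (kprod a b) = kprod (koszul a) b - kprod (kbar a) (koszul b).
Proof.
elim/KR_ind: a => [|a a' ha hb|p a ha||i a ha].
- by rewrite kprod0l !raddf0 !kprod0l subr0.
- by rewrite kprodDl !raddfD /= !kprodDl ha hb addrACA opprD.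
- by rewrite kprod_smull !koszul_smul kbar_smul !kprod_smull ha raddfB.
- by rewrite koszul1 kbar1 kprod1l kprod0l kprodNl kprod1l opprK add0r.
- rewrite wedge_kprod !koszul_wedge ha kbar_wedge raddfB /= kprodBl kprod_smull kprodNl
  !wedge_kprod.
  by rewrite opprK opprB addrA addrAC.
Qed.
End Operators.

(** * Acyclicity modulo ideals with linear quotients *)

Section Support.
Variables (K : fieldType) (n : nat).
Local Notation mon := 'X_{1..n}.
Local Notation S := {mpoly K[n]}.
Local Notation KR := (KR K n).
Implicit Types (a b c : KR) (p : S) (i j l : 'I_n) (F G H : {set 'I_n}) (m g : mon).
Implicit Types (Q : mon -> {set 'I_n} -> bool).

(** Q selects basis elements x^m e_F. Membership in a monomial ideal, bidegree and absence of
    variables are all conditions of this form. *)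
Definition supp_in Q a := forall m F, (a F)@_m != 0 -> Q m F.

Definition proj Q a : KR :=
  [ffun F : {set 'I_n} => \sum_(m <- msupp (a F) | Q m F) (a F)@_m *: 'X_[m]].

(** Division by x^g, where terms that g does not divide are dropped. *)
Definition shift g a : KR :=
  [ffun F : {set 'I_n} => \sum_(m <- msupp (a F) | (g <= m)%MM) (a F)@_m *: 'X_[m - g]].

Lemma coef_ext a b : (forall F m, (a F)@_m = (b F)@_m) -> a = b.
Proof. by move=> e; apply/ffunP => F; apply/mpolyP => m. Qed.

Lemma coef_proj Q a m F : (proj Q a F)@_m = if Q m F then (a F)@_m else 0.
Proof.
rewrite ffunE raddf_sum /= (eq_bigr (fun m' => (a F)@_m * (m' == m)%:R)); last first.
  by move=> m' _; rewrite mcoeffZ mcoeffX; case: eqP => [->|]; rewrite ?mulr0.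
rewrite -big_filter; case: (boolP (m \in [seq m' <- msupp (a F) | Q m' F])) => mF.
  rewrite (bigD1_seq m) //= ?filter_uniq //= eqxx mulr1 big1 => [|m' /negPf ->];
    last by rewrite mulr0.
  by move: mF; rewrite mem_filter addr0 => /andP[->].
rewrite big1_seq => [|m' /= m'F]; last first.
  by case: eqP m'F => [->|]; rewrite ?(negPf mF) ?mulr0.
by move: mF; rewrite mem_filter; case: ifP => //= _ /memN_msupp_eq0 ->.
Qed.

Lemma coef_shift g a m F : (shift g a F)@_m = (a F)@_(m + g).
Proof.
rewrite ffunE raddf_sum /= (eq_bigr (fun m' => (a F)@_(m + g) * (m' == m + g)%MM%:R));
  last first.
  move=> m' gm; rewrite mcoeffZ mcoeffX; case: eqP => [<-|ne]; first by rewrite submK // eqxx.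
  by case: eqP => [e|]; rewrite ?mulr0 //; case: ne; rewrite e addmK.
rewrite -big_filter; case: (boolP (m + g \in [seq m' <- msupp (a F) | g <= m'])%MM) => mF.
  by rewrite (bigD1_seq (m + g)%MM) //= ?filter_uniq //= eqxx mulr1 big1 ?addr0 => [|m'
    /negPf ->]; last by rewrite mulr0.
rewrite big1_seq => [|m' /= m'F]; last first.
  by case: eqP m'F => [->|]; rewrite ?(negPf mF) ?mulr0.
by move: mF; rewrite mem_filter lem_addl /= => /memN_msupp_eq0 ->.
Qed.

Lemma coef_mulX g p m : ('X_[g] * p)@_m = if (g <= m)%MM then p@_(m - g) else 0.
Proof.
case: ifP => gm; first by rewrite mulrC -{1}(submK gm) addmC mcoeffMX.
apply/eqP; rewrite mcoeff_eq0 mulrC (perm_mem (msuppMX _ _)); apply/negP => /mapP[m' _ mE].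
by rewrite mE lem_addr in gm.
Qed.

Lemma coef_sign k p m : ((-1) ^+ k * p)@_m = (-1) ^+ k * p@_m.
Proof.
by rewrite -signr_odd -[in RHS]signr_odd; case: odd;
  rewrite ?expr1 ?expr0 ?mul1r // !mulN1r mcoeffN.
Qed.

Lemma coef_koszul a m H : (koszul a H)@_m = \sum_(i | i \notin H)
  (-1) ^+ nbelow i H * (if (U_(i) <= m)%MM then (a (i |: H))@_(m - U_(i)) else 0).
Proof.
by rewrite ffunE raddf_sum; apply: eq_bigr => i _; rewrite /= coef_sign coef_mulX.
Qed.

Fact proj_is_additive Q : {morph proj Q : a b / a - b}.
Proof.
move=> a b; apply: coef_ext => F m; rewrite coef_proj !ffunE !mcoeffB.
have := coef_proj Q a m F; have := coef_proj Q b m F; rewrite !ffunE => -> ->.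
by case: ifP; rewrite ?subr0.
Qed.
HB.instance Definition _ Q := GRing.isZmodMorphism.Build KR KR (proj Q) (proj_is_additive Q).

Lemma supp_in0 Q : supp_in Q 0.
Proof. by move=> m F; rewrite ffunE mcoeff0 eqxx. Qed.

Lemma supp_inN Q a : supp_in Q a -> supp_in Q (- a).
Proof. by move=> ha m F; rewrite ffunE mcoeffN oppr_eq0; apply: ha. Qed.

Lemma supp_inD Q a b : supp_in Q a -> supp_in Q b -> supp_in Q (a + b).
Proof.
move=> ha hb m F; rewrite ffunE mcoeffD.
by have [->|/ha //] := eqVneq (a F)@_m 0; rewrite add0r => /hb.
Qed.

Lemma supp_inB Q a b : supp_in Q a -> supp_in Q b -> supp_in Q (a - b).
Proof. by move=> ha hb; apply: supp_inD => //; apply: supp_inN. Qed.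

Lemma supp_in_sum (I : Type) (r : seq I) (P : pred I) (f : I -> KR) Q :
  (forall x, P x -> supp_in Q (f x)) -> supp_in Q (\sum_(x <- r | P x) f x).
Proof. by move=> h; elim/big_ind: _ => //; [apply: supp_in0|apply: supp_inD]. Qed.

Lemma supp_in_sub Q Q' a : (forall m F, Q m F -> Q' m F) -> supp_in Q a -> supp_in Q' a.
Proof. by move=> h ha m F /ha /h. Qed.

Lemma supp_in_proj Q a : supp_in Q (proj Q a).
Proof. by move=> m F; rewrite coef_proj; case: ifP; rewrite ?eqxx. Qed.

Lemma supp_in_projW Q Q' a : supp_in Q a -> supp_in Q (proj Q' a).
Proof. by move=> ha m F; rewrite coef_proj; case: ifP; rewrite ?eqxx // => _ /ha. Qed.

Lemma proj_id Q a : supp_in Q a -> proj Q a = a.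
Proof.
move=> ha; apply: coef_ext => F m; rewrite coef_proj.
by have [->|/ha ->//] := eqVneq (a F)@_m 0; case: ifP.
Qed.

Lemma proj_eq0 Q a : proj Q a = 0 <-> supp_in (fun m F => ~~ Q m F) a.
Proof.
split=> [/ffunP e m F|h].
  by apply: contra => QmF; move: (e F) => /mpolyP/(_ m);
    rewrite coef_proj QmF ffunE mcoeff0 => ->.
apply: coef_ext => F m; rewrite coef_proj ffunE mcoeff0; case: ifP => // QmF.
by apply/eqP; apply: contraT => /h; rewrite QmF.
Qed.

Lemma supp_in_koszul Q Q' a :
  (forall m H i, i \notin H -> (U_(i) <= m)%MM -> Q (m - U_(i))%MM (i |: H) -> Q' m H) ->
  supp_in Q a -> supp_in Q' (koszul a).
Proof.
move=> h ha m H; rewrite coef_koszul; apply: contraR => Q'm.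
rewrite big1 // => i iH; case: ifP => im; last by rewrite mulr0.
have [->|/ha /h] := eqVneq (a (i |: H))@_(m - U_(i)) 0; first by rewrite mulr0.
by move=> /(_ iH im) Q'm'; rewrite Q'm' in Q'm.
Qed.

(** A selection of basis elements that is constant along the terms of the differential commutes with
    it. This serves for bidegrees and for indices that do not occur. *)
Lemma proj_koszul Q Q' a :
  (forall m H i, i \notin H -> (U_(i) <= m)%MM -> Q (m - U_(i))%MM (i |: H) = Q' m H) ->
  koszul (proj Q a) = proj Q' (koszul a).
Proof.
move=> h; apply: coef_ext => H m; rewrite coef_proj !coef_koszul.
have [Q'm|Q'm] := ifP.
  apply: eq_bigr => i iH; congr (_ * _); case: ifP => // im.
  by rewrite coef_proj h // Q'm.
rewrite big1 // => i iH; case: ifP => im; last by rewrite mulr0.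
by rewrite coef_proj h // Q'm mulr0.
Qed.

Lemma coefM_neq0 p q m : (p * q)@_m != 0 ->
  exists m1 m2, [/\ m = (m1 + m2)%MM, p@_m1 != 0 & q@_m2 != 0].
Proof.
rewrite -mcoeff_msupp => /msuppM_le /allpairsP[[m1 m2] /= [h1 h2 ->]].
by exists m1, m2; rewrite -!mcoeff_msupp.
Qed.

Lemma supp_in_kprod Q1 Q2 Q a b :
  (forall m1 m2 F G, [disjoint F & G] -> Q1 m1 F -> Q2 m2 G -> Q (m1 + m2)%MM (F :|: G)) ->
  supp_in Q1 a -> supp_in Q2 b -> supp_in Q (kprod a b).
Proof.
move=> h ha hb m H; rewrite ffunE raddf_sum; apply: contraR => Qm /=.
rewrite big1 // => F _; rewrite raddf_sum big1 //= => G /andP[dFG /eqP HE].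
rewrite coef_sign; have [->|] := eqVneq (a F * b G)@_m 0; first by rewrite mulr0.
move/coefM_neq0 => [m1 [m2 [mE /ha h1 /hb h2]]].
by rewrite mE -HE (h _ _ _ _ dFG h1 h2) in Qm.
Qed.

Lemma supp_in_kbar Q a : supp_in Q a -> supp_in Q (kbar a).
Proof.
move=> ha m F; rewrite ffunE coef_sign mulf_eq0 negb_or => /andP[_]; exact: ha.
Qed.

Lemma mnm_subU_eq i m : (U_(i) <= m)%MM = (0 < m i)%N.
Proof. by rewrite lep1mP lt0n. Qed.

(* Contracts the part of the complex whose multidegree involves the index i. *)
Definition homotopy i a := wedge i (shift U_(i)%MM a).

Lemma coef_smulX g a m F :
  (smul 'X_[g] a F)@_m = if (g <= m)%MM then (a F)@_(m - g) else 0.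
Proof. by rewrite ffunE coef_mulX. Qed.

Lemma coef_wedge i a m H :
  (wedge i a H)@_m = if i \in H then (-1) ^+ nbelow i H * (a (H :\ i))@_m else 0.
Proof. by rewrite ffunE; case: ifP; rewrite ?mcoeff0 // coef_sign. Qed.

Lemma kcoefD a b m H : ((a + b) H)@_m = (a H)@_m + (b H)@_m.
Proof. by rewrite ffunE mcoeffD. Qed.

Lemma kcoefB a b m H : ((a - b) H)@_m = (a H)@_m - (b H)@_m.
Proof. by rewrite !ffunE mcoeffB. Qed.

(** Division by x_i commutes with multiplication by x_l for l different from i, so these terms
    cancel by the sign rule of [wedge]. The terms of index i give back x^m e_F, except when i occurs
    neither in m nor in F. *)
Lemma homotopyE i a :
  koszul (homotopy i a) + homotopy i (koszul a) =
  a - proj (fun m F => (m i == 0)%N && (i \notin F)) a.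
Proof.
apply: coef_ext => H m; rewrite /homotopy koszul_wedge kcoefD !kcoefB.
rewrite coef_smulX !coef_wedge coef_proj !coef_shift !coef_koszul.
case: (boolP (i \in H)) => iH; last first.
  rewrite andbT mnm_subU_eq subr0 addr0 lt0n; case: eqP => /= mi; first by rewrite subrr.
  by rewrite subr0 submK // mnm_subU_eq lt0n; apply/eqP.
rewrite andbF subr0 -addrA -mulrN -mulrDr addrC.
have iHi : i \notin H :\ i by rewrite !inE eqxx.
rewrite (bigD1 i) //= [X in _ * (_ + X)](bigD1 i) //=.
rewrite coef_shift setD1K // lem_addl addmK.
have nH : nbelow i (H :\ i) = nbelow i H by rewrite [RHS](nbelowD1 i iH) ltnn.
rewrite nH. set s1 := \sum_(i0 < n | _) _; set s2 := \sum_(i0 < n | _) _.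
have -> : s1 = s2.
  apply: eq_bigr => l /andP[lH li]; rewrite !mnm_subU_eq mnmDE mnm1E eq_sym (negPf li) addn0.
  case: ifP => // lm; rewrite coef_shift.
  have -> // : (m + U_(i) - U_(l) = m - U_(l) + U_(i))%MM.
  apply/mnmP => x; rewrite !mnmDE !mnmBE mnmDE addnBAC //.
  by apply/mnm_lepP; rewrite mnm_subU_eq.
rewrite opprD addrACA addNr addr0 -mulrN -mulrDr signrMK.
case: ifP => // im; last by rewrite oppr0 add0r addr0.
by rewrite submK // addNr add0r.
Qed.

Definition in_vars (V : {set 'I_n}) m (F : {set 'I_n}) := [exists j in V, 0 < m j]%N.

(** Division by x_i does not change the exponents of the variables in V. *)
Lemma supp_in_homotopy (V : {set 'I_n}) i a : i \notin V ->
  supp_in (in_vars V) a -> supp_in (in_vars V) (homotopy i a).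
Proof.
move=> iV ha m H; rewrite coef_wedge; case: ifP => iH; last by rewrite eqxx.
rewrite mulf_eq0 negb_or coef_shift => /andP[_ /ha/exists_inP[j jV]].
rewrite mnmDE mnm1E; case: eqP => [ij|_]; first by rewrite ij jV in iV.
by rewrite addn0 => mj; apply/exists_inP; exists j.
Qed.

(** The variables outside V are contracted one after another. In what remains no index outside V
    occurs, and no coefficient has a constant term, so each monomial involves a variable of V. *)
Lemma cycle_mod_vars V a :
  supp_in (fun m F => m != 0%MM) a -> supp_in (in_vars V) (koszul a) ->
  exists c, supp_in (in_vars V) (a - koszul c).
Proof.
move=> a0 ha.
pose off (vs : seq 'I_n) := fun m (F : {set 'I_n}) =>
  all (fun i => (m i == 0)%N && (i \notin F)) vs.
suff [c hc] : exists c, supp_in (in_vars V) (a - koszul c - proj (off (enum (~: V))) a).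
  exists c; rewrite -(subrK (proj (off (enum (~: V))) a) (a - _)); apply: supp_inD => // m F.
  rewrite coef_proj; case: ifP => [/allP hm /a0 m0|]; last by rewrite eqxx.
  have [i mi] : exists i, m i != 0%N.
    apply/existsP; apply: contraR m0; rewrite negb_exists => /forallP h.
    by apply/eqP/mnmP => i; rewrite mnm0E; apply/eqP; have := h i; rewrite negbK.
  apply/exists_inP; exists i; rewrite ?lt0n //.
  by apply: contraT => iV; have := hm i; rewrite mem_enum inE iV (negPf mi) => /(_ isT).
have: all (fun i => i \notin V) (enum (~: V)) by apply/allP => i; rewrite mem_enum inE.
elim: (enum _) => [_|i vs IH /= /andP[iV /IH [c hc]]].
  by exists 0; rewrite raddf0 subr0 proj_id ?subrr //; exact: supp_in0.
set a1 := proj (off vs) a in hc.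
(* The new error is [homotopy i (koszul a1)]. It lies in the ideal (V), because [koszul a1] is a
   part of [koszul a] and i is not in V. *)
exists (c + homotopy i a1).
have -> : proj (off (i :: vs)) a = proj (fun m F => (m i == 0)%N && (i \notin F)) a1.
  by apply: coef_ext => F m; rewrite !coef_proj /=;
    case: ((m i == 0)%N && (i \notin F)) => //; case: ifP.
have -> : proj (fun m F => (m i == 0)%N && (i \notin F)) a1 =
    a1 - (koszul (homotopy i a1) + homotopy i (koszul a1)).
  by rewrite homotopyE opprB addrC subrK.
have -> : a - koszul (c + homotopy i a1) -
    (a1 - (koszul (homotopy i a1) + homotopy i (koszul a1))) =
   (a - koszul c - a1) + homotopy i (koszul a1).
  set h := koszul (homotopy i a1); set k := homotopy i (koszul a1).
  by rewrite raddfD /= -/h [- (koszul c + h)]opprD opprB !addrA subrK addrAC.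
apply: supp_inD => //; apply: supp_in_homotopy => //.
rewrite (proj_koszul (Q' := off vs)); first exact: supp_in_projW.
move=> m H l lH lm; apply/allP/allP => h j /h; rewrite mnmBE mnm1E !inE;
  case: (eqVneq l j) => [<-|_]; rewrite ?subn0 ?andbF //=.
by rewrite mnm_subU_eq lt0n in lm; rewrite (negPf lm).
Qed.

(* The head of the list is the last generator of the linear quotient order. *)
Fixpoint linear_quotient_seq (gs : seq mon) : Prop :=
  if gs is g :: gs' then
    (forall u, u \in gs' -> exists2 j, (g j < u j)%N & inI gs' (g + U_(j))%MM) /\
    linear_quotient_seq gs'
  else True.

Definition in_idl (gs : seq mon) m (F : {set 'I_n}) := inI gs m.

Lemma inI_le gs m m' : (m <= m')%MM -> inI gs m -> inI gs m'.
Proof. by move=> mm' /hasP[g ggs gm]; apply/hasP; exists g => //; apply: lepm_trans mm'. Qed.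

Lemma supp_in_idl_koszul gs a : supp_in (in_idl gs) a -> supp_in (in_idl gs) (koszul a).
Proof.
by apply: supp_in_koszul => m H i _ _; apply: inI_le; apply: lem_subr.
Qed.

(** The colon ideal (gs) : g is generated by the variables x_j with x_j g in (gs). Indeed, if u in
    gs divides x^m g and u_j > g_j, then x_j divides x^m. *)
Lemma inI_linear_quotient g gs m : linear_quotient_seq (g :: gs) ->
  inI gs (m + g)%MM = [exists j in [set j | inI gs (g + U_(j))%MM], 0 < m j]%N.
Proof.
move=> [lq _]; apply/idP/exists_inP => [/hasP[u ugs um]|[j]].
  have [j gu hj] := lq u ugs; exists j; rewrite ?inE //.
  by move/mnm_lepP/(_ j): um; rewrite mnmDE; case: (m j) => //; rewrite add0n leqNgt gu.
rewrite inE => hj mj; apply: inI_le hj; apply/mnm_lepP => x.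
by rewrite !mnmDE mnm1E addnC leq_add2r; case: eqP => // <-.
Qed.

(* Writing koszul a = g b + r with r in (gs), the cofactor b is a cycle modulo the *)
(* variables generating the colon ideal (gs) : g.  If b = koszul c modulo them, then *)
(* a - g c is a cycle modulo (gs). *)
Lemma cycle_boundary gs e a : linear_quotient_seq gs -> all (fun g => mdeg g <= e)%N gs ->
  (0 < e)%N -> supp_in (fun m F => mdeg m == e) a -> supp_in (in_idl gs) (koszul a) ->
  exists b, supp_in (in_idl gs) (a - koszul b).
Proof.
move=> + + e0; elim: gs a => [|g gs IH] a.
  (* The ideal is zero here. With V empty, [cycle_mod_vars] is the acyclicity of the Koszul complex
     over S in positive coefficient degree. *)
  move=> _ _ ae ha; have [|m F|c hc] := @cycle_mod_vars set0 a.
  - by move=> m F /ae; apply: contraTneq => ->; rewrite mdeg0 eq_sym -lt0n.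
  - by move/ha.
  by exists c => m F /hc /exists_inP[j]; rewrite inE.
move=> lqg /= /andP[ge gse] ae ha; have [_ lq] := lqg.
have hV := inI_linear_quotient _ lqg; move: hV; set V := [set j | _] => hV.
pose r := proj (in_idl gs) (koszul a); pose b := shift g (koszul a - r).
(* A term of [koszul a] that g does not divide lies in (gs), hence is part of r. *)
have bE : smul 'X_[g] b = koszul a - r.
  apply: coef_ext => F m; rewrite coef_smulX; case: ifP => gm;
    first by rewrite coef_shift submK.
  apply/esym/eqP; apply: contraFT gm => hm.
  have /(_ m F hm) : supp_in (in_idl (g :: gs)) (koszul a - r).
    by apply: supp_inB => //; apply: supp_in_projW.
  rewrite /in_idl /= => /orP[//|hm']; move: hm; rewrite kcoefB coef_proj.
  by rewrite /in_idl hm' subrr eqxx.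
have koszul_e : supp_in (fun m F => mdeg m == e.+1) (koszul a).
  apply: supp_in_koszul ae => m H i _ im /eqP <-.
  by rewrite -{1}(submK im) mdegD mdeg1 addn1.
have be : supp_in (fun m F => mdeg m == (e.+1 - mdeg g)%N) b.
  have re : supp_in (fun m F => mdeg m == e.+1) r by apply: supp_in_projW.
  move=> m F; rewrite coef_shift => /(supp_inB koszul_e re).
  by rewrite mdegD => /eqP <-; rewrite addnK.
have rgs : supp_in (in_idl gs) r by apply: supp_in_proj.
(* The coefficient degree of b is e + 1 - deg g, which is positive as deg g <= e. Moreover g d(b) =
   - d(r) lies in (gs), so d(b) lies in the colon ideal (V). *)
have [|m F hm|c hc] := @cycle_mod_vars V b.
- move=> m F /be; apply: contraTneq => ->; rewrite mdeg0 eq_sym subn_eq0 -ltnNge.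
  by rewrite ltnS.
- have := supp_in_idl_koszul (supp_inN rgs).
  have -> : koszul (- r) = smul 'X_[g] (koszul b).
    by rewrite -koszul_smul bE raddfB /= koszul_koszul sub0r raddfN.
  move/(_ (m + g)%MM F); rewrite coef_smulX lem_addl addmK /in_idl hV.
  exact.
(* Taking a homogeneous part of c keeps a - g c' in coefficient degree e, as the induction
   hypothesis requires. *)
pose c' := proj (fun m F => mdeg m == e - mdeg g)%N c.
have hc' : supp_in (in_vars V) (b - koszul c').
  rewrite (proj_koszul (Q' := fun m F => mdeg m == (e.+1 - mdeg g)%N)).
    by rewrite -{1}(proj_id be) -raddfB; apply: supp_in_projW.
  by move=> m H i _ im; rewrite -{2}(submK im) mdegD mdeg1 addn1 subSn // eqSS.
have [||b1 hb1] := IH (a - smul 'X_[g] c') lq gse.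
- apply: supp_inB => // m F; rewrite coef_smulX; case: ifP => [gm|]; last by rewrite eqxx.
  by move/(@supp_in_proj _ c) => /eqP mg; rewrite -(submK gm) mdegD mg subnK.
- have -> : koszul (a - smul 'X_[g] c') = r + smul 'X_[g] (b - koszul c').
    by rewrite raddfB /= koszul_smul raddfB /= bE [RHS]addrA [r + _]addrC subrK.
  apply: supp_inD => // m F; rewrite coef_smulX; case: ifP => [gm|]; last by rewrite eqxx.
  by move/hc'; rewrite /in_vars -hV /in_idl submK.
exists b1; rewrite -(subrK (smul 'X_[g] c') (a - _)); apply: supp_inD.
  by rewrite addrAC; apply: supp_in_sub hb1 => m F; rewrite /in_idl /= orbC => ->.
by move=> m F; rewrite coef_smulX /in_idl /=; case: ifP; rewrite ?eqxx.
Qed.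
End Support.

(** * A homogeneous basis of the Koszul homology *)

Section Reduction.
Variables (K : fieldType) (n : nat) (gens : seq 'X_{1..n}).
Local Notation mon := 'X_{1..n}.
Local Notation KR := (KR K n).
Implicit Types (a b c : KR) (F G H : {set 'I_n}) (m : mon).

Definition notin_idl m (F : {set 'I_n}) := ~~ inI gens m.

Lemma reduceE a : reduce gens a = proj notin_idl a.
Proof. by apply/ffunP => F; rewrite !ffunE. Qed.

Lemma kdiffE a : kdiff gens a = proj notin_idl (koszul a).
Proof. by rewrite /kdiff reduceE. Qed.

Lemma kmulE a b : kmul gens a b = proj notin_idl (kprod a b).
Proof. by rewrite /kmul reduceE. Qed.

Lemma proj_eq a b : proj notin_idl a = proj notin_idl b <-> supp_in (in_idl gens) (a - b).
Proof.
have e : supp_in (in_idl gens) (a - b) <-> proj notin_idl (a - b) = 0.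
  rewrite proj_eq0; split=> h m F /h; rewrite /notin_idl negbK //.
rewrite e raddfB /=; split=> [->|/eqP]; first by rewrite subrr.
by rewrite subr_eq0 => /eqP.
Qed.

Lemma proj_notin_eq0 a : proj notin_idl a = 0 <-> supp_in (in_idl gens) a.
Proof. by rewrite -[0](raddf0 (proj notin_idl)) proj_eq subr0. Qed.

Lemma projK_eq a : supp_in (in_idl gens) (proj notin_idl a - a).
Proof. by apply/proj_eq/proj_id/supp_in_proj. Qed.

Lemma supp_in_idl_kprodl gs a b : supp_in (in_idl gs) a -> supp_in (in_idl gs) (kprod a b).
Proof.
move=> ha; apply: (supp_in_kprod (Q2 := fun _ _ => true) _ ha) => // m1 m2 F G _ h _.
exact: inI_le (lem_addr _ _) h.
Qed.

Lemma supp_in_idl_kprodr gs a b : supp_in (in_idl gs) b -> supp_in (in_idl gs) (kprod a b).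
Proof.
move=> ha; apply: (supp_in_kprod (Q1 := fun _ _ => true) _ _ ha) => // m1 m2 F G _ _ h.
exact: inI_le (lem_addl _ _) h.
Qed.

Lemma kdiff_reduce a : kdiff gens (proj notin_idl a) = kdiff gens a.
Proof.
rewrite !kdiffE; apply/proj_eq; rewrite -raddfB; apply: supp_in_idl_koszul.
exact: projK_eq.
Qed.

Lemma kmul_reduce a b :
  kmul gens (kbar (proj notin_idl a)) (proj notin_idl b) = proj notin_idl (kprod (kbar a) b).
Proof.
rewrite kmulE; apply/proj_eq; set a' := proj _ a; set b' := proj _ b.
rewrite -(subrKA (kprod (kbar a) b')) -raddfB -kprodBl -raddfB; apply: supp_inD.
  by apply: supp_in_idl_kprodl; apply: supp_in_kbar; apply: projK_eq.
by apply: supp_in_idl_kprodr; apply: projK_eq.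
Qed.

Lemma kcoefZ (x : K) a m F : ((x *: a) F)@_m = x * (a F)@_m.
Proof. by rewrite ffunE mcoeffZ. Qed.

Lemma proj_scale Q (x : K) a : proj Q (x *: a) = x *: proj Q a.
Proof.
by apply: coef_ext => F m; rewrite kcoefZ !coef_proj kcoefZ; case: ifP; rewrite ?mulr0.
Qed.

Lemma koszul_scale (x : K) a : koszul (x *: a) = x *: koszul a.
Proof. by rewrite !scale_smul koszul_smul. Qed.

Lemma kdiff_scale (x : K) a : kdiff gens (x *: a) = x *: kdiff gens a.
Proof. by rewrite !kdiffE koszul_scale proj_scale. Qed.

Lemma kdiffD a b : kdiff gens (a + b) = kdiff gens a + kdiff gens b.
Proof. by rewrite !kdiffE !raddfD. Qed.

(** Homological degree k and coefficient degree e; the differential goes from (k, e) to (k - 1, e +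
    1). *)
Definition bideg k e m F := (#|F| == k) && (mdeg m == e).

(** The target is expressed by [#|F|.+1 == k], because k - 1 would be truncated for k = 0, where the
    differential vanishes. *)
Lemma koszul_bideg k e a : koszul (proj (bideg k e) a) =
  proj (fun m F => (#|F|.+1 == k) && (mdeg m == e.+1)) (koszul a).
Proof.
apply: proj_koszul => m H i iH im; rewrite /bideg cardsU1 iH add1n.
by rewrite -{2}(submK im) mdegD mdeg1 addn1 eqSS.
Qed.

Lemma projC Q Q' a : proj Q (proj Q' a) = proj Q' (proj Q a).
Proof. by apply: coef_ext => F m; rewrite !coef_proj; do 2![case: ifP]. Qed.

Lemma kcycle_bideg k e a : kcycle gens a -> kcycle gens (proj (bideg k e) a).
Proof.
rewrite /kcycle /reduced kdiffE !reduceE => -[ra ka]; split.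
  by rewrite projC ra.
by rewrite kdiffE koszul_bideg projC ka raddf0.
Qed.

Lemma proj_bideg_sum a N E : (n <= N)%N -> (forall F, msize (a F) <= E)%N ->
  a = \sum_(k < N.+1) \sum_(e < E) proj (bideg k e) a.
Proof.
move=> nN aE; apply: coef_ext => F m; rewrite sum_ffunE raddf_sum /=.
have Fn : (#|F| < N.+1)%N.
  by rewrite ltnS (leq_trans (max_card _)) ?card_ord.
rewrite (bigD1 (Ordinal Fn)) //= [X in _ + X]big1 ?addr0 => [|k kF]; last first.
  rewrite sum_ffunE raddf_sum /= big1 // => e _; rewrite coef_proj /bideg.
  by case: eqP => //= Fk; case/eqP: kF; apply: val_inj.
rewrite sum_ffunE raddf_sum /=; have [mE|mE] := ltnP (mdeg m) E.
  rewrite (bigD1 (Ordinal mE)) //= big1 ?addr0 => [|e em].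
    by rewrite coef_proj /bideg !eqxx.
  rewrite coef_proj /bideg; case: (mdeg m =P e) => [me|]; last by rewrite andbF.
  by case/eqP: em; apply: val_inj.
have am : (a F)@_m = 0.
  by apply/memN_msupp_eq0/msize_mdeg_ge/(leq_trans (aE F)).
by rewrite am big1 // => e _; rewrite coef_proj am; case: ifP.
Qed.

(** A candidate for the basis, stored with its bidegree. The bound D confines the candidates to a
    finite-dimensional space. *)
Definition good D (x : KR * (nat * nat)) :=
  [/\ kcycle gens x.1, (1 <= x.2.1)%N, (1 <= x.2.2)%N, (x.2.2 < D)%N &
      supp_in (bideg x.2.1 x.2.2) x.1].

Definition combination (c : nat -> K) (fam : seq (KR * (nat * nat))) : KR :=
  \sum_(i < size fam) c i *: (nth (0 : KR, (0%N, 0%N)) fam i).1.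

Definition independent fam := forall c : nat -> K, kboundary gens (combination c fam) ->
  forall i, (i < size fam)%N -> c i = 0.

Lemma kboundary0 : kboundary gens (0 : KR).
Proof. by exists 0; rewrite kdiffE !raddf0. Qed.

(** With more elements than there are pairs (m, F) with deg m < D, the coefficient matrix has a
    nontrivial left kernel. It gives a combination equal to 0, which is a boundary. *)
Lemma independent_bounded D : exists N, forall fam,
  (forall x, x \in fam -> good D x) -> independent fam -> (size fam <= N)%N.
Proof.
pose T := ('X_{1..n < D} * {set 'I_n})%type.
exists #|{: T}| => fam gfam ind; rewrite leqNgt; apply/negP => lt.
pose A := \matrix_(i < size fam, j < #|{: T}|)
   ((nth (0 : KR, (0%N, 0%N)) fam i).1 (enum_val j).2)@_(enum_val j).1.
have : ~~ row_free A.
  by rewrite /row_free neq_ltn (leq_ltn_trans (rank_leq_col _) lt).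
rewrite -kermx_eq0 => /rowV0Pn[v /sub_kermxP vA v0].
case/eqP: v0; apply/rowP => i; rewrite mxE.
pose c k := if insub k is Some i then v 0 i else 0.
have cE (j : 'I_(size fam)) : c j = v 0 j by rewrite /c valK.
rewrite -cE; apply: ind => //.
have -> : combination c fam = 0; last exact: kboundary0.
apply: coef_ext => F m; rewrite sum_ffunE raddf_sum ffunE mcoeff0 /=.
have [mD|mD] := ltnP (mdeg m) D.
  pose j := enum_rank ((BMultinom mD, F) : T).
  have := congr1 (fun B : 'rV_ _ => B 0 j) vA; rewrite mxE [RHS]mxE => vAj; rewrite -[RHS]vAj.
  by apply: eq_bigr => k _; rewrite kcoefZ mxE enum_rankK cE.
rewrite big1 // => k _; rewrite kcoefZ.
have [_ _ _ eD hs] := gfam _ (mem_nth (0 : KR, (0%N, 0%N)) (ltn_ord k)).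
have [->|/hs/andP[_ /eqP me]] := eqVneq (((nth (0 : KR, (0%N, 0%N)) fam k).1 F)@_m) 0;
  first by rewrite mulr0.
by rewrite me leqNgt eD in mD.
Qed.

Lemma exists_maximal_family D : exists fam,
  [/\ forall x, x \in fam -> good D x, independent fam &
      forall x, good D x -> ~ independent (x :: fam)].
Proof.
have [N hN] := independent_bounded D.
pose P k := exists fam, [/\ forall x, x \in fam -> good D x, independent fam & size fam = k].
have P0 : P 0%N by exists [::]; split.
have {}hN k : P k -> (k <= N)%N by move=> [fam [h1 h2 <-]]; apply: hN.
have [k [[fam [h1 h2 h3]] h4]] : exists k, P k /\ ~ P k.+1.
  apply: NNPP => h; have Pk k : P k.
    by elim: k => // k IH; apply: NNPP => nP; apply: h; exists k.
  by have := hN _ (Pk N.+1); rewrite ltnn.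
exists fam; split=> // x gx ind; apply: h4; exists (x :: fam); split=> //;
  last by rewrite /= h3.
by move=> y; rewrite inE => /predU1P[->|/h1].
Qed.

Definition spanned fam a :=
  exists (c : nat -> K) (b : KR), a = combination c fam + kdiff gens b.

Lemma spannedD fam a b : spanned fam a -> spanned fam b -> spanned fam (a + b).
Proof.
move=> [c1 [b1 ->]] [c2 [b2 ->]]; exists (fun i => c1 i + c2 i), (b1 + b2).
rewrite kdiffD addrACA; congr (_ + _); rewrite -big_split /=.
by apply: eq_bigr => i _; rewrite scalerDl.
Qed.

Lemma spanned_boundary fam b : spanned fam (kdiff gens b).
Proof.
exists (fun=> 0), b; rewrite /combination big1 ?add0r // => i _.
by rewrite scale0r.
Qed.

Lemma spanned0 fam : spanned fam 0.
Proof. by have [b ->] := kboundary0; apply: spanned_boundary. Qed.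

(** By maximality, adding x creates a relation modulo boundaries. Its coefficient at x is nonzero by
    independence of [fam], so it can be solved for x. *)
Lemma spanned_good D fam x : independent fam ->
  (forall x, good D x -> ~ independent (x :: fam)) -> good D x -> spanned fam x.1.
Proof.
move=> ind hmax gx; apply: NNPP => nsp; apply: (hmax x gx) => c.
rewrite /combination big_ord_recl /= => -[b hb].
have c0 : c 0%N = 0.
  apply: NNPP => /eqP c0; apply: nsp.
  exists (fun i => - (c 0%N)^-1 * c i.+1), ((c 0%N)^-1 *: b).
  rewrite kdiff_scale -hb scalerDr scalerA mulVf // scale1r.
  rewrite addrCA -[LHS]addr0; congr (_ + _).
  rewrite scaler_sumr -big_split big1 // => i _ /=.
  by rewrite scalerA -scalerDl mulNr addNr scale0r.
case=> [//|i]; rewrite ltnS => ilt; apply: (ind (fun i => c i.+1)) ilt.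
by exists b; rewrite -hb c0 scale0r add0r.
Qed.

End Reduction.

(** * The trivial Massey operation *)

Section Massey.
Variables (K : fieldType) (n : nat).
Local Notation mon := 'X_{1..n}.
Local Notation KR := (KR K n).
Implicit Types (a b c : KR) (F G H : {set 'I_n}) (m : mon) (gs : seq mon).

Definition truncation gs j := [seq g <- gs | mdeg g <= j]%N.

Lemma inI_truncation_le gs i j m :
  (i <= j)%N -> inI (truncation gs i) m -> inI (truncation gs j) m.
Proof.
move=> ij /hasP[g]; rewrite mem_filter => /andP[gi ggs] gm; apply/hasP; exists g => //.
by rewrite mem_filter ggs (leq_trans gi ij).
Qed.

Lemma inI_truncation gs j m : inI gs m -> (mdeg m <= j)%N -> inI (truncation gs j) m.
Proof.
move=> /hasP[g ggs gm] mj; apply/hasP; exists g => //; rewrite mem_filter ggs andbT.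
by apply: leq_trans mj; rewrite -(submK gm) mdegD leq_addl.
Qed.

Lemma inI_truncationW gs j m : inI (truncation gs j) m -> inI gs m.
Proof. by move=> /hasP[g]; rewrite mem_filter => /andP[_ ggs] gm; apply/hasP; exists g. Qed.

(** The chain found by [cycle_boundary] may be replaced by its component in bidegree (k + 1, e - 1),
    whose differential is the component in bidegree (k, e). *)
Lemma cycle_boundary_bideg gs j k e a : linear_quotient_seq (truncation gs j) ->
  (0 < e)%N -> (j <= e)%N -> supp_in (bideg k e) a ->
  supp_in (in_idl (truncation gs j)) (koszul a) ->
  exists2 b, supp_in (bideg k.+1 e.-1) b & supp_in (in_idl (truncation gs j)) (koszul b - a).
Proof.
move=> lq e0 je hae hka.
have [||b hb] := cycle_boundary lq _ e0 _ hka.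
- by apply/allP => g; rewrite mem_filter => /andP[gj _]; apply: leq_trans je.
- by apply: supp_in_sub hae => m F /andP[].
exists (proj (bideg k.+1 e.-1) b); first exact: supp_in_proj.
rewrite koszul_bideg -opprB; apply: supp_inN.
rewrite -{1}(proj_id hae).
have -> : proj (fun m H => (#|H|.+1 == k.+1) && (mdeg m == e.-1.+1)) (koszul b) =
          proj (bideg k e) (koszul b).
  by apply: coef_ext => F m; rewrite !coef_proj prednK // eqSS.
by rewrite -raddfB; apply: supp_in_projW.
Qed.

Section Construction.
Variables (M : nat) (z : 'I_M -> KR) (dz ez : 'I_M -> nat) (gs : seq mon).
Hypothesis lq : forall j, linear_quotient_seq (truncation gs j).
Hypothesis dz_gt0 : forall k, (0 < dz k)%N.
Hypothesis ez_gt0 : forall k, (0 < ez k)%N.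
Hypothesis z_bideg : forall k, supp_in (bideg (dz k) (ez k)) (z k).
Hypothesis z_cycle : forall k, supp_in (in_idl gs) (koszul (z k)).
Implicit Types (s : seq 'I_M) (mu : seq 'I_M -> KR).

Definition hdeg s := (\sum_(k <- s) dz k + size s - 1)%N.
(** Products add coefficient degrees and each bounding lowers them by one, which leaves the sum
    minus (r - 1) for r factors. The subtraction is not truncated, since each [ez k] is positive. *)
Definition cdeg s := ((\sum_(k <- s) ez k).+1 - size s)%N.
Definition level s := (\max_(k <- s) ez k).+1.

Definition massey_rhs mu s : KR :=
  \sum_(1 <= j < size s) kprod (kbar (mu (take j s))) (mu (drop j s)).

(* The equation for the Massey operation is required modulo the smaller ideal *)
(* I_(level s), the only one modulo which the next obstructions bound. *)
Definition massey_spec mu s b := supp_in (bideg (hdeg s) (cdeg s)) b /\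
  supp_in (in_idl (truncation gs (level s))) (koszul b - massey_rhs mu s).

Lemma size_le_sum (f : 'I_M -> nat) s :
  (forall k, 0 < f k)%N -> (size s <= \sum_(k <- s) f k)%N.
Proof.
move=> f0; elim: s => [|k s IH]; first by rewrite big_nil.
by rewrite big_cons /= -add1n leq_add.
Qed.

Lemma level_cat s t : level (s ++ t) = maxn (level s) (level t).
Proof. by rewrite /level big_cat /= maxnSS. Qed.

Lemma level_take j s : (level (take j s) <= level s)%N.
Proof. by rewrite -{2}(cat_take_drop j s) level_cat leq_maxl. Qed.

Lemma level_drop j s : (level (drop j s) <= level s)%N.
Proof. by rewrite -{2}(cat_take_drop j s) level_cat leq_maxr. Qed.

(** All entries other than a maximal one contribute at least 1 to the sum. This is the inequality
    that makes the obstruction, of coefficient degree [(cdeg s).+1], bound modulo I_(level s). *)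
Lemma level_le_cdeg s : (2 <= size s)%N -> (level s <= (cdeg s).+1)%N.
Proof.
have H (t : seq 'I_M) : (0 < size t)%N ->
    (\max_(k <- t) ez k + (size t).-1 <= \sum_(k <- t) ez k)%N.
  elim: t => // k t IH _; rewrite !big_cons /=.
  case: (posnP (size t)) => [/size0nil ->|t0]; first by rewrite !big_nil maxn0.
  have := IH t0; have := size_le_sum t ez_gt0; have := ez_gt0 k.
  lia.
move=> s2; have := H s (ltnW s2); rewrite /level /cdeg; lia.
Qed.

Lemma massey_rhs_bideg mu s : (2 <= size s)%N ->
  (forall t, (0 < size t < size s)%N -> massey_spec mu t (mu t)) ->
  supp_in (bideg (hdeg s).-1 (cdeg s).+1) (massey_rhs mu s).
Proof.
move=> s2 h; rewrite /massey_rhs big_seq; apply: supp_in_sum => j.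
rewrite mem_index_iota => /andP[j1 js].
have st : size (take j s) = j by rewrite size_takel // ltnW.
have sd : size (drop j s) = (size s - j)%N by rewrite size_drop.
have [ht _] : massey_spec mu (take j s) (mu (take j s)) by apply: h; rewrite st j1.
have [hd _] : massey_spec mu (drop j s) (mu (drop j s)) by apply: h; rewrite sd; lia.
apply: supp_in_kprod (supp_in_kbar ht) hd => m1 m2 F G dFG.
move=> /andP[/eqP F1 /eqP m1E] /andP[/eqP G1 /eqP m2E]; rewrite /bideg mdegD.
have -> : #|F :|: G| = (#|F| + #|G|)%N.
  by rewrite cardsU (eqP (_ : F :&: G == set0)) ?cards0 ?subn0 // setI_eq0.
rewrite F1 G1 m1E m2E /hdeg /cdeg st sd.
have := size_le_sum (take j s) ez_gt0; have := size_le_sum (drop j s) ez_gt0.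
have split_sum (f : 'I_M -> nat) :
    (\sum_(k <- s) f k = \sum_(k <- take j s) f k + \sum_(k <- drop j s) f k)%N.
  by rewrite -big_cat cat_take_drop.
rewrite !split_sum st sd.
move=> h1 h2; apply/andP; split; apply/eqP; lia.
Qed.

(** The Leibniz rule and the equations for shorter sequences produce each triple product with cuts i
    < j twice, with opposite signs. What is left are products with the error terms r and r', which
    lie in truncations of lower or equal level. *)
Lemma massey_rhs_cycle mu s :
  (forall t, (0 < size t < size s)%N -> massey_spec mu t (mu t)) ->
  supp_in (in_idl (truncation gs (level s))) (koszul (massey_rhs mu s)).
Proof.
move=> h; set J := in_idl _.
pose N := size s.
pose x j := mu (take j s); pose y j := mu (drop j s).
pose r j := koszul (x j) - massey_rhs mu (take j s).
pose r' j := koszul (y j) - massey_rhs mu (drop j s).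
have rJ j : (1 <= j < N)%N -> supp_in J (r j).
  move=> /andP[j1 jN]; have [|_ h2] := h (take j s).
    by rewrite size_takel ?j1 // ltnW.
  by apply: supp_in_sub h2 => m F; apply: inI_truncation_le; apply: level_take.
have r'J j : (1 <= j < N)%N -> supp_in J (r' j).
  move=> /andP[j1 jN]; have [|_ h2] := h (drop j s); first by rewrite size_drop; lia.
  by apply: supp_in_sub h2 => m F; apply: inI_truncation_le; apply: level_drop.
pose T i j := kprod (x i) (kprod (kbar (mu (take (j - i) (drop i s)))) (y j)).
have E1 j : (1 <= j < N)%N ->
    kprod (kbar (massey_rhs mu (take j s))) (y j) = - \sum_(1 <= i < N | (i < j)%N) T i j.
  move=> /andP[j1 jN]; rewrite /massey_rhs raddf_sum size_takel; last exact: ltnW.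
  rewrite kprod_suml -sumrN.
  rewrite (@big_nat_widen _ _ _ 1%N j N xpredT _ (ltnW jN)).
  apply: congr_big_nat => // i /andP[/= ij /andP[i1 iN]].
  rewrite kbar_kprod kbarK kprodNl kprodA /T /x (take_takel _ (ltnW ij)) take_drop.
  by rewrite (subnK (ltnW ij)).
have E2 i : (1 <= i < N)%N ->
    kprod (x i) (massey_rhs mu (drop i s)) = \sum_(1 <= j < N | (i < j)%N) T i j.
  move=> /andP[i1 iN]; rewrite /massey_rhs raddf_sum size_drop /=.
  rewrite -(@big_nat_widenl _ _ _ i.+1 1%N N xpredT _ (ltn0Sn i)) -[i.+1]add1n big_addn.
  apply: eq_bigr => l _; rewrite /T addnK /y drop_drop.
  reflexivity.
have -> : koszul (massey_rhs mu s) =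
   \sum_(1 <= j < N) (- kprod (kbar (r j)) (y j) - kprod (x j) (r' j)).
  rewrite /massey_rhs raddf_sum /= -/N.
  transitivity (\sum_(1 <= j < N) ((- kprod (kbar (r j)) (y j) - kprod (x j) (r' j)) +
     (- kprod (kbar (massey_rhs mu (take j s))) (y j) -
       kprod (x j) (massey_rhs mu (drop j s))))).
    apply: eq_bigr => j _; rewrite koszul_kprod koszul_kbar kbarK kprodNl.
    rewrite addrACA -!opprD -kprodDl -kprodDr -raddfD /= /r /r' !subrK.
    by [].
  rewrite big_split /= -[RHS]addr0; congr (_ + _); rewrite big_split /=.
  rewrite !sumrN.
  rewrite (eq_big_nat _ _ E1) (eq_big_nat _ _ E2) sumrN opprK.
  apply/eqP; rewrite subr_eq0; apply/eqP.
  exact: exchange_big_dep_nat.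
rewrite big_seq; apply: supp_in_sum => j; rewrite mem_index_iota => jN.
apply: supp_inB; first apply: supp_inN.
  by apply: supp_in_idl_kprodl; apply: supp_in_kbar; apply: rJ.
by apply: supp_in_idl_kprodr; apply: r'J.
Qed.

Lemma massey_step_exists mu s : (2 <= size s)%N ->
  (forall t, (0 < size t < size s)%N -> massey_spec mu t (mu t)) ->
  exists b, massey_spec mu s b.
Proof.
move=> s2 h.
have [b hb1 hb2] := cycle_boundary_bideg (lq (level s)) (ltn0Sn (cdeg s)) (level_le_cdeg s2)
  (massey_rhs_bideg s2 h) (massey_rhs_cycle h).
exists b; split=> //; move: hb1; rewrite prednK // /hdeg.
by rewrite subn_gt0 ltn_addl.
Qed.

(** The right-hand side is an empty sum. The differential of z_k lies in I and has coefficient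
    degree e_k + 1, which is the level, so it already lies in that truncation. *)
Lemma massey_spec1 mu k : massey_spec mu [:: k] (z k).
Proof.
rewrite /massey_spec /hdeg /cdeg /level /massey_rhs !big_seq1 /= addnK subn1 big_geq // subr0.
split=> // m F hm; apply: inI_truncation; first exact: z_cycle hm.
have /eqP -> // : mdeg m == (ez k).+1.
apply: (@supp_in_koszul _ _ (bideg (dz k) (ez k)) (fun m F => mdeg m == (ez k).+1)) hm => //.
by move=> {}m H i _ im /andP[_ /eqP <-]; rewrite -{1}(submK im) mdegD mdeg1 addn1.
Qed.

Definition massey_step mu s : KR :=
  if s is [:: k] then z k else epsilon (inhabits 0) (massey_spec mu s).

(** Recursion on length by iteration: the value on a sequence depends only on strictly shorter
    nonempty ones, so [size s] rounds suffice and the initial value 0 does not enter. *)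
Definition massey s := iter (size s) massey_step (fun=> 0) s.

Lemma massey_rhs_ext mu mu' s :
  (forall t, (0 < size t < size s)%N -> mu t = mu' t) -> massey_rhs mu s = massey_rhs mu' s.
Proof.
move=> h; apply: eq_big_nat => j /andP[j1 js]; rewrite !h //.
  by rewrite size_drop; lia.
by rewrite size_takel ?j1 // ltnW.
Qed.

Lemma massey_step_ext mu mu' s :
  (forall t, (0 < size t < size s)%N -> mu t = mu' t) -> massey_step mu s = massey_step mu' s.
Proof.
move=> h; have e := massey_rhs_ext h.
by case: s h e => [|k [|k' s]] h e //=; rewrite /massey_spec e.
Qed.

Lemma iter_massey N s : (0 < size s <= N)%N -> iter N massey_step (fun=> 0) s = massey s.
Proof.
elim/ltn_ind: N s => N IH s /andP[s0 sN].
case: N sN IH => [|N] sN IH; first by move: s0; rewrite ltnNge sN.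
rewrite /massey -(prednK s0) !iterS; apply: massey_step_ext => t /andP[t0 ts].
rewrite !IH ?t0 //=; lia.
Qed.

Lemma masseyE s : (0 < size s)%N -> massey s = massey_step massey s.
Proof.
move=> s0; rewrite {1}/massey -(prednK s0) iterS; apply: massey_step_ext => t /andP[t0 ts].
by rewrite iter_massey // t0; lia.
Qed.

Lemma masseyP s : (0 < size s)%N -> massey_spec massey s (massey s).
Proof.
elim: {s}(size s).+1 {-2}s (ltnSn (size s)) => // N IH s sN s0.
rewrite [X in massey_spec _ _ X]masseyE //.
case: s s0 sN => [|k [|k' s]] // s0 sN; first exact: massey_spec1.
apply: epsilon_spec; apply: massey_step_exists => // t /andP[t0 ts].
by apply: IH => //; apply: leq_trans ts _.
Qed.

End Construction.
(** For i in F the differential contains x_i e_(F - i) with coefficient plus or minus that of e_F.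
    As I has no elements of degree 1, this coefficient must vanish. *)
Lemma cycle_cdeg0 gens k a : (0 < k)%N -> (forall m, inI gens m -> 1 < mdeg m)%N ->
  supp_in (bideg k 0) a -> supp_in (in_idl gens) (koszul a) -> a = 0.
Proof.
move=> k0 h1 ha hka; apply: coef_ext => F m; rewrite ffunE mcoeff0.
apply/eqP; apply: contraT => am.
have /andP[/eqP Fk] := ha _ _ am; rewrite mdeg_eq0 => /eqP m0.
have [i iF] : exists i, i \in F by apply/set0Pn; rewrite -card_gt0 Fk.
suff /hka/h1 : (koszul a (F :\ i))@_U_(i) != 0 by rewrite mdeg1.
rewrite coef_koszul (bigD1 i) ?inE ?eqxx //= lepm_refl setD1K // big1 ?addr0.
  have -> : (U_(i) - U_(i) = 0)%MM by apply/mnmP => x; rewrite mnmBE mnm0E subnn.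
  by rewrite -m0 mulf_eq0 signr_eq0.
move=> l /andP[_ li]; rewrite mnm_subU_eq mnm1E eq_sym (negPf li).
by rewrite mulr0.
Qed.

Theorem golod_of_linear_quotients gens gs :
  inI gs =1 inI gens -> (forall j, linear_quotient_seq (truncation gs j)) ->
  (forall m, inI gens m -> 1 < mdeg m)%N -> Golod K gens.
Proof.
move=> gsE lq deg_gt1.
(* All generators have degree below D, so I_D = I and cycles of coefficient degree at least D
   bound. *)
pose D := (\max_(g <- gs) mdeg g).+1.
have [fam [gfam ind hmax]] := exists_maximal_family K gens D.
pose d0 := ((0 : KR), (0%N, 0%N)).
pose x (k : 'I_(size fam)) := nth d0 fam k.
have gx k : good gens D (x k) by apply/gfam/mem_nth.
pose z k := (x k).1; pose dz k := (x k).2.1; pose ez k := (x k).2.2.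
have idlE a : supp_in (in_idl gs) a <-> supp_in (in_idl gens) a.
  by split=> h m F /h; rewrite /in_idl gsE.
have zc k : supp_in (in_idl gs) (koszul (z k)).
  by have [[_ h] _ _ _ _] := gx k; apply/idlE/proj_notin_eq0; rewrite -kdiffE.
have dz0 k : (0 < dz k)%N by have [] := gx k.
have ez0 k : (0 < ez k)%N by have [] := gx k.
have zb k : supp_in (bideg (dz k) (ez k)) (z k) by have [] := gx k.
pose mu s := massey z dz ez gs s.
have muP s : (0 < size s)%N -> massey_spec dz ez gs mu s (mu s) by exact: masseyP.
have zr k : proj (notin_idl gens) (z k) = z k.
  by have [[h _] _ _ _ _] := gx k; rewrite -reduceE.
(* Three ranges: cycles with e = 0 vanish, those with 0 < e < D are spanned by maximality of [fam],
   and those with e >= D are boundaries. *)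
have spanned_cycle k e a :
    kcycle gens a -> (k == 0%N -> a = 0) -> supp_in (bideg k e) a -> spanned gens fam a.
  move=> ca a0 hae; have [k0|k0] := posnP k; first by rewrite a0 ?k0 //; apply: spanned0.
  have [ra] := ca; rewrite kdiffE => /proj_notin_eq0 ka.
  have [e0|e0] := posnP e.
    rewrite e0 in hae; rewrite (cycle_cdeg0 k0 deg_gt1 hae ka); exact: spanned0.
  have [eD|De] := ltnP e D.
    by apply: (@spanned_good _ _ _ D fam (a, (k, e)) ind hmax).
  have [|b _ hb] := cycle_boundary_bideg (lq D) e0 De hae.
    move=> m F /ka; rewrite /in_idl -gsE => /hasP[g ggs gm]; apply/hasP; exists g => //.
    by rewrite mem_filter ggs andbT leqW // leq_bigmax_seq.
  suff -> : a = kdiff gens b by apply: spanned_boundary.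
  rewrite -ra reduceE kdiffE; apply/proj_eq; rewrite -opprB; apply: supp_inN.
  apply/idlE => m F /hb; exact: inI_truncationW.
exists (size fam), z, dz, (fun s => reduce gens (mu s)); split; [split|split].
- move=> k; have [h1 h2 _ _ h3] := gx k; split=> //; split=> // F Fk.
  apply/mpolyP => m; rewrite mcoeff0; apply/eqP; apply: contraT => /h3/andP[/eqP].
  by move=> /Fk.
- move=> c hc k; pose c' i := if insub i is Some i then c i else 0.
  have cE (j : 'I_(size fam)) : c' j = c j by rewrite /c' valK.
  rewrite -cE; apply: ind => //; rewrite /combination.
  by rewrite (eq_bigr (fun k => c k *: z k)) // => i _; rewrite cE.
- move=> a ca a0.
  have [c [b ab]] : spanned gens fam a; last by exists (fun k => c k), b.
  have [E aE] : exists E, forall F, (msize (a F) <= E)%N.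
    by exists (\max_F msize (a F)) => F; apply: leq_bigmax.
  rewrite (proj_bideg_sum (leqnn n) aE).
  elim/big_ind: _ => [||k _]; [exact: spanned0|exact: spannedD|].
  elim/big_ind: _ => [||e _]; [exact: spanned0|exact: spannedD|].
  apply: (spanned_cycle k e); [exact: kcycle_bideg| |exact: supp_in_proj].
  move=> /eqP k0; apply: coef_ext => F m; rewrite coef_proj /bideg k0 cards_eq0.
  by case: eqP => [->|]; rewrite ffunE mcoeff0 // a0 mcoeff0; case: ifP.
- by move=> k; rewrite reduceE /mu masseyE //= zr.
- move=> s s0; have [h _] := muP s s0; split; first by rewrite /reduced !reduceE proj_id //;
  apply: supp_in_proj.
  move=> F Fs; rewrite reduceE; apply/mpolyP => m; rewrite mcoeff0; apply/eqP; apply: contraT.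
  by move=> /(supp_in_projW h)/andP[/eqP].
- move=> s s2; have [_ h] := muP s (ltnW s2).
  rewrite !reduceE kdiff_reduce kdiffE.
  under eq_bigr do rewrite !reduceE kmul_reduce.
  rewrite -raddf_sum; apply/proj_eq; apply/idlE => m F /h; exact: inI_truncationW.
Qed.

End Massey.

(** * From the power to the ideal *)

Section MonomialIdeals.
Variables (K : fieldType) (n : nat).
Local Notation mon := 'X_{1..n}.
Implicit Types (m u v w g : mon).

Lemma in_mon_idealX (P : mon -> Prop) m :
  in_mon_ideal (K := K) P 'X_[m] <-> exists2 v, P v & (v <= m)%MM.
Proof.
split=> [[vs [c [Pvs mE]]]|[v Pv vm]]; last first.
  exists [:: v], (fun=> 'X_[m - v]); split; first by move=> w; rewrite inE => /eqP ->.
  by rewrite big_seq1 -mpolyXD submK.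
have [/hasP[v vvs vm]|/hasPn h] := boolP (has (fun v => v <= m)%MM vs).
  by exists v => //; apply: Pvs.
have /eqP := congr1 (mcoeff m) mE; rewrite mcoeffX eqxx raddf_sum big1_seq ?oner_eq0 //=.
by move=> v vvs; rewrite mulrC coef_mulX (negPf (h v vvs)).
Qed.

Lemma mnm_le_anti u v : (u <= v)%MM -> (v <= u)%MM -> u = v.
Proof.
move=> /mnm_lepP uv /mnm_lepP vu; apply/mnmP => i.
by apply/eqP; rewrite eqn_leq uv vu.
Qed.

Lemma mnm_le_mdeg u v : (u <= v)%MM -> (mdeg v <= mdeg u)%N -> u = v.
Proof.
move=> uv dvu; rewrite -(submK uv); have : mdeg (v - u) == 0%N.
  by move: dvu; rewrite -{1}(submK uv) mdegD -{2}[mdeg u]add0n leq_add2r leqn0.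
by rewrite mdeg_eq0 => /eqP ->; rewrite add0m.
Qed.

Definition minimal_gens (gens : seq mon) :=
  [seq g <- undup gens | all (fun g' => (g' <= g)%MM ==> (g' == g)) gens].

Lemma minimal_gensP gens g :
  reflect (g \in gens /\ forall g', g' \in gens -> (g' <= g)%MM -> g' = g)
    (g \in minimal_gens gens).
Proof.
rewrite mem_filter mem_undup; apply: (iffP andP) => [[/allP h ->]|[-> h]]; split=> //.
  by move=> g' /h /implyP h' /h' /eqP.
by apply/allP => g' /h h'; apply/implyP => /h' ->.
Qed.

Lemma exists_minimal_gen gens g :
  g \in gens -> exists2 g', g' \in minimal_gens gens & (g' <= g)%MM.
Proof.
elim: {g}(mdeg g).+1 {-2}g (ltnSn (mdeg g)) => // k IH g gk ggens.
have [h|/allPn[g' g'gens]] := boolP (all (fun g' => (g' <= g)%MM ==> (g' == g)) gens).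
  by exists g; rewrite ?lepm_refl // mem_filter h mem_undup.
rewrite negb_imply => /andP[g'g ne].
have [|w wm wg'] := IH g' _ g'gens; last by exists w => //; apply: lepm_trans g'g.
rewrite ltnS in gk; apply: leq_trans gk; rewrite ltnNge.
by apply: contra ne => /(mnm_le_mdeg g'g) ->.
Qed.

Lemma inI_minimal_gens gens : inI (minimal_gens gens) =1 inI gens.
Proof.
move=> m; apply/hasP/hasP.
  by move=> [g /minimal_gensP[ggens _] gm]; exists g.
move=> [g /exists_minimal_gen[w wm wg] gm].
by exists w => //; apply: lepm_trans gm.
Qed.

Lemma mnm_sum_nseq s v : (\sum_(g <- nseq s v) g = v *+ s)%MM.
Proof. by elim: s => [|s IH]; rewrite /= ?big_nil ?mulm0n // big_cons IH mulmS. Qed.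

Lemma mnm_le_sum (t : seq mon) g : g \in t -> (g <= \sum_(w <- t) w)%MM.
Proof.
elim: t => // w t IH; rewrite inE big_cons => /predU1P[->|/IH h]; first exact: lem_addr.
exact: lepm_trans h (lem_addl _ _).
Qed.

Section Powers.
Variables (gens : seq mon) (s : nat) (le : rel mon).
Hypothesis sqf : all (@squarefree n) gens.
Hypothesis s_gt0 : (0 < s)%N.
Hypothesis mon_le : monomial_order le.

Let le_refl : reflexive le. Proof. by have [[]] := mon_le. Qed.
Let le_anti : antisymmetric le. Proof. by have [[]] := mon_le. Qed.
Let le_trans : transitive le. Proof. by have [[]] := mon_le. Qed.
Let le_total : total le. Proof. by have [[]] := mon_le. Qed.
Let leD m1 m2 m : le m1 m2 -> le (m1 + m)%MM (m2 + m)%MM.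
Proof. by have [_ [h _]] := mon_le; apply: h. Qed.

Lemma leDD m1 m2 m3 m4 : le m1 m2 -> le m3 m4 -> le (m1 + m3)%MM (m2 + m4)%MM.
Proof.
move=> h1 h2; apply: le_trans (leD m3 h1) _.
by rewrite ![(m2 + _)%MM]addmC; apply: leD.
Qed.

Lemma mnm_le_le u v : (u <= v)%MM -> le u v.
Proof.
move=> uv; rewrite -(submK uv) -{1}[u]add0m; apply: leD.
by have [_ [_]] := mon_le.
Qed.

Lemma le_muln u v k : le u v -> le (u *+ k)%MM (v *+ k)%MM.
Proof. by move=> uv; elim: k => [|k IH]; rewrite ?mulm0n // !mulmS leDD. Qed.

Lemma le_sum v t : all (le v) t -> le (v *+ size t)%MM (\sum_(g <- t) g)%MM.
Proof.
elim: t => [_|g t IH /= /andP[vg /IH h]]; first by rewrite big_nil mulm0n.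
by rewrite big_cons mulmS leDD.
Qed.

(** Where v has exponent 0, the two bounds agree; elsewhere g has exponent at most 1, which v
    already covers. *)
Lemma sqf_le g m v j : g \in gens -> (g <= U_(j) + v *+ s)%MM -> (g <= v + U_(j))%MM.
Proof.
move=> /(allP sqf)/forallP g1 /mnm_lepP h; apply/mnm_lepP => x.
have := h x; have := g1 x; rewrite !mnmDE mulmnE mnm1E.
case: (v x) => [|k]; first by rewrite mul0n addn0 add0n.
by move=> gx _; apply: leq_trans gx _; rewrite addSn.
Qed.

(** If t_1 ... t_s divides v^s, each square-free t_i involves only variables of v. Hence t_i divides
    v, and t_i = v by minimality. *)
Lemma min_gens_muln v : v \in minimal_gens gens -> min_gens K (pow_gen gens s) (v *+ s)%MM.
Proof.
move=> /minimal_gensP[vgens vmin]; split=> [|m].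
  apply/in_mon_idealX; exists (v *+ s)%MM; last exact: lepm_refl.
  by exists (nseq s v); rewrite size_nseq mnm_sum_nseq all_nseq /= vgens orbT.
move=> /in_mon_idealX[_ [t [st tgens ->]] tm] mv.
suff tE : t = nseq s v.
  by apply: mnm_le_anti mv _; rewrite -mnm_sum_nseq -tE.
rewrite -st; apply/all_pred1P/allP => g gt; apply/eqP/vmin; first exact: (allP tgens).
have /mnm_lepP h := lepm_trans (mnm_le_sum gt) (lepm_trans tm mv).
apply/mnm_lepP => x; have := h x; rewrite mulmnE.
have /forallP/(_ x) := allP sqf g (allP tgens g gt).
by case: (v x) => [|k] g1; [rewrite mul0n | move=> _; apply: leq_trans g1 _].
Qed.

Lemma linear_quotient_step u v :
  linear_quotients K (min_gens K (pow_gen gens s)) (fun v u => le v u /\ v <> u) ->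
  u \in minimal_gens gens -> v \in minimal_gens gens -> le u v -> u <> v ->
  exists w j, [/\ w \in minimal_gens gens, le w v, w <> v, (v j < u j)%N & (w <= v + U_(j))%MM].
Proof.
move=> lq um vm uv ne.
have Gu := min_gens_muln um; have Gv := min_gens_muln vm.
have uvs : le (u *+ s)%MM (v *+ s)%MM /\ (u *+ s)%MM <> (v *+ s)%MM.
  split; first exact: le_muln.
  move=> /mnmP h; apply: ne; apply/mnmP => x; have := h x; rewrite !mulmnE.
  by move/eqP; rewrite eqn_pmul2r // => /eqP.
have [|V hV] := lq _ Gv; first by exists (u *+ s)%MM.
(* The truncated difference is u^s / gcd(u^s, v^s). It lies in the colon ideal, so some variable x_j
   of V divides it, which forces v_j < u_j. *)
have /hV/in_mon_idealX[_ [j jV ->]] : in_mon_ideal (K := K)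
    (fun w => min_gens K (pow_gen gens s) w /\ (le w (v *+ s)%MM /\ w <> (v *+ s)%MM))
    ('X_[(u *+ s - v *+ s)%MM] * 'X_[(v *+ s)%MM]).
  rewrite -mpolyXD; apply/in_mon_idealX; exists (u *+ s)%MM => //.
  by apply/mnm_lepP => x; rewrite mnmDE mnmBE; lia.
rewrite mnm_subU_eq mnmBE subn_gt0 !mulmnE ltn_mul2r => /andP[_ vuj].
have /hV : in_mon_ideal (K := K) (fun m => exists2 j, j \in V & m = U_(j)%MM) 'X_j.
  by apply/in_mon_idealX; exists U_(j)%MM; [exists j|exact: lepm_refl].
rewrite -mpolyXD => /in_mon_idealX[w [[wI wmin] [wv wne]] wle].
have /in_mon_idealX[_ [t [st tgens ->]] tw] := wI.
have {}wmin : (\sum_(g <- t) g)%MM = w.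
  by apply: wmin => //; apply/in_mon_idealX; exists (\sum_(g <- t) g)%MM;
    [exists t|exact: lepm_refl].
(* If all factors were at least v, their product w would be at least v^s. *)
have /hasP[g gt /andP[gv gne]] : has (fun g => le g v && (g != v)) t.
  apply: contraT => /hasPn h; case: wne; apply: le_anti; rewrite wv /= -wmin -st.
  apply: le_sum; apply/allP => g /h; rewrite negb_and negbK.
  by have /orP[->|->] := le_total v g => //= /eqP ->.
have ggens := allP tgens g gt.
have [g' g'm g'g] := exists_minimal_gen ggens.
exists g', j; split=> //.
- exact: le_trans (mnm_le_le g'g) gv.
- move=> g'v; case/eqP: gne; apply: le_anti; rewrite gv /= -g'v; exact: mnm_le_le.
- apply: lepm_trans g'g _; apply: sqf_le => //.
  by apply: lepm_trans wle; rewrite -wmin; apply: mnm_le_sum.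
Qed.

(** With the degree compared first, a generator preceding v survives in every truncation that
    contains v. *)
Definition deg_le u v := (mdeg u < mdeg v)%N || (mdeg u == mdeg v) && le u v.

Lemma deg_le_mdeg u v : deg_le u v -> (mdeg u <= mdeg v)%N.
Proof. by case/orP=> [/ltnW|/andP[/eqP -> _]]. Qed.

Lemma deg_le_total : total deg_le.
Proof. by move=> u v; rewrite /deg_le; case: ltngtP => //= _; apply: le_total. Qed.

Lemma deg_le_trans : transitive deg_le.
Proof.
move=> v u w; rewrite /deg_le => /orP[uv|/andP[/eqP -> uv]] /orP[vw|/andP[/eqP <- vw]].
- by rewrite (ltn_trans uv vw).
- by rewrite uv.
- by rewrite vw.
- by rewrite eqxx (le_trans uv vw) orbT.
Qed.

Lemma deg_le_anti : antisymmetric deg_le.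
Proof.
move=> u v; rewrite /deg_le; case: ltngtP => //= _; exact: le_anti.
Qed.

(** If [le u v], then [linear_quotient_step] applies, and its w has degree at most deg v, as
    otherwise w = x_j v would not be minimal. If u is larger for [le] but of smaller degree, the
    step for the pair v, u gives w below u, of degree at most deg u. This w may replace u, and one
    descends until [le w v]. *)
Lemma linear_quotient_deg_step u v :
  linear_quotients K (min_gens K (pow_gen gens s)) (fun v u => le v u /\ v <> u) ->
  u \in minimal_gens gens -> v \in minimal_gens gens -> deg_le u v -> u <> v ->
  exists w j, [/\ w \in minimal_gens gens, deg_le w v, w <> v, (v j < u j)%N &
    (w <= v + U_(j))%MM].
Proof.
move=> lq um vm uv ne.
have step a b : a \in minimal_gens gens -> b \in minimal_gens gens -> le a b -> a <> b ->
  exists w j, [/\ w \in minimal_gens gens, le w b /\ w <> b, (mdeg w <= mdeg b)%N,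
    (b j < a j)%N & (w <= b + U_(j))%MM].
  move=> am bm ab abne; have [w [j [wm wb wne bj wle]]] :=
    linear_quotient_step lq am bm ab abne.
  exists w, j; split=> //; rewrite leqNgt; apply/negP => dwb; apply: wne.
  have wE : w = (b + U_(j))%MM by apply: mnm_le_mdeg wle _; rewrite mdegD mdeg1 addn1.
  have [_ wmin] := minimal_gensP _ _ wm; have [bg _] := minimal_gensP _ _ bm.
  by apply/esym/wmin => //; rewrite wE lem_addr.
have early a : a \in minimal_gens gens -> le a v -> a <> v ->
  exists w j, [/\ w \in minimal_gens gens, deg_le w v, w <> v, (v j < a j)%N &
    (w <= v + U_(j))%MM].
  move=> am av ane; have [w [j [wm [wv wne] dwv vj wle]]] := step _ _ am vm av ane.
  exists w, j; split=> //; rewrite /deg_le wv andbT; by case: ltngtP dwv.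
have [/early|nuv] := boolP (le u v); first exact.
have {}uv : (mdeg u < mdeg v)%N by move: uv; rewrite /deg_le (negPf nuv) andbF orbF.
(* The descent is measured by the number of minimal generators strictly below u. *)
pose rank a := count (fun b => le b a && (b != a)) (minimal_gens gens).
elim: {u}(rank u).+1 {-2}u (ltnSn (rank u)) um ne nuv uv => // k IH u uk um ne nuv uv.
have vu : le v u by have := le_total u v; rewrite (negPf nuv).
have [//|w [j [wm [wu wne] dwu uj wle]]] := step v u vm um vu.
  by move=> e; apply: ne.
have dwv : (mdeg w < mdeg v)%N by apply: leq_ltn_trans uv.
have wnev : w <> v by move=> e; rewrite e ltnn in dwv.
suff [w' [j' [w'm w'v w'ne vj' w'le]]] :
  exists w' j', [/\ w' \in minimal_gens gens, deg_le w' v, w' <> v,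
    (v j' < w j')%N & (w' <= v + U_(j'))%MM].
  (* Away from j, w is bounded by u. At j its exponent is at most u_j + 1 <= v_j, so j' = j is
     excluded. *)
  exists w', j'; split=> //; have /mnm_lepP/(_ j') := wle.
  rewrite mnmDE mnm1E; case: eqP => [jj'|_]; last by rewrite addn0; apply: leq_trans vj'.
  by move: vj'; rewrite -jj'; lia.
have [/early|nwv] := boolP (le w v); first exact.
rewrite ltnS in uk; apply: IH => //; apply: leq_trans uk; rewrite /rank.
rewrite -!size_filter; apply: (@leq_trans (size (w :: filter (fun b => le b w && (b != w))
  (minimal_gens gens)))) => //.
apply: uniq_leq_size => [|b].
  rewrite /= mem_filter eqxx andbF /= filter_uniq //; exact/filter_uniq/undup_uniq.
rewrite inE => /predU1P[->|]; first by rewrite mem_filter wm wu andbT; apply/eqP.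
rewrite !mem_filter => /andP[/andP[bw bne] ->]; rewrite (le_trans bw wu) /=.
rewrite andbT; apply: contra bne => /eqP bu.
by apply/eqP/le_anti; rewrite bw bu wu.
Qed.

(** The list is decreasing, so a w strictly below the head lies in the tail, and a w strictly below
    an element of the tail cannot be the head. *)
Lemma linear_quotient_sorted (gs : seq mon) : uniq gs -> pairwise (fun u v => deg_le v u) gs ->
  (forall u v, u \in gs -> v \in gs -> deg_le u v -> u <> v ->
     exists w j, [/\ w \in gs, deg_le w v, w <> v, (v j < u j)%N & (w <= v + U_(j))%MM]) ->
  linear_quotient_seq gs.
Proof.
elim: gs => // g gs IH /= /andP[ggs ugs] /andP[/allP gle pgs] h.
have tl x : x \in gs -> x \in g :: gs by rewrite inE orbC => ->.
split.
  move=> u us; have [|w [j [ws _ wg gj wle]]] := h u g (tl _ us) (mem_head _ _) (gle u us).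
    by move=> e; rewrite -e us in ggs.
  exists j => //; apply/hasP; exists w => //.
  by move: ws; rewrite inE => /predU1P[/wg|].
apply: IH => // u v us vs uv ne.
have [w [j [ws wv wne vj wle]]] := h u v (tl _ us) (tl _ vs) uv ne.
exists w, j; split=> //; move: ws; rewrite inE => /predU1P[wg|//].
have gv : g = v by apply: deg_le_anti; rewrite (gle v vs) -wg wv.
by rewrite gv vs in ggs.
Qed.

Lemma exists_linear_quotient_seq :
  linear_quotients K (min_gens K (pow_gen gens s)) (fun v u => le v u /\ v <> u) ->
  exists2 gs, inI gs =1 inI gens & forall j, linear_quotient_seq (truncation gs j).
Proof.
move=> lq; pose gs := sort (fun u v => deg_le v u) (minimal_gens gens).
have gsE : gs =i minimal_gens gens by apply: mem_sort.
exists gs => [m|j].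
  rewrite -(inI_minimal_gens gens); exact: eq_has_r.
apply: linear_quotient_sorted => [||u v].
- by rewrite filter_uniq // sort_uniq filter_uniq // undup_uniq.
- apply: pairwise_filter; rewrite -sorted_pairwise.
    by apply: sort_sorted => x y; apply: deg_le_total.
  by move=> x y w h1 h2; apply: deg_le_trans h2 h1.
- rewrite !mem_filter !gsE => /andP[uj um] /andP[vj vm] uv ne.
  have [w [i [wm wv wne vi wle]]] := linear_quotient_deg_step lq um vm uv ne.
  exists w, i; split=> //; rewrite mem_filter gsE wm andbT.
  exact: leq_trans (deg_le_mdeg wv) vj.
Qed.

End Powers.
(* For n = 0 nothing prevents I from being the unit ideal. *)
Lemma golod_no_variable (gens : seq mon) : n = 0%N -> Golod K gens.
Proof.
move=> n0; have noI (i : 'I_n) : False by case: i; rewrite n0.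
have K0 (a b : KR K n) : a set0 = b set0 -> a = b.
  move=> ab; apply/ffunP => F; suff -> : F = set0 by [].
  by apply/setP => i; case: (noI i).
exists 0%N, (fun=> 0), (fun=> 0%N), (fun=> 0); split; last by split=> -[|[]].
split=> [[]//|c _ []//|a _ a0|[]//].
by exists (fun=> 0), 0; apply: K0; rewrite big_ord0 add0r a0 kdiffE !raddf0 ffunE.
Qed.

End MonomialIdeals.

Theorem theorem2p10 (K : fieldType) (n : nat) (gens : seq 'X_{1..n}) :
  (* I = (gens) is a square-free monomial ideal of S = K[x_1..x_n] *)
  all (@squarefree n) gens ->
  (* I contains no variable *)
  (forall i : 'I_n, ~ @in_mon_ideal K n (fun m => m \in gens) 'X_i) ->
  forall s : nat, (1 <= s)%N ->
  (* I^s has linear quotients w.r.t. (the restriction to G(I^s) of) a monomial order *)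
  (exists le : rel 'X_{1..n}, monomial_order le /\
     linear_quotients K (min_gens K (pow_gen gens s)) (fun v u => le v u /\ v <> u)) ->
  (* S/I is Golod *)
  Golod K gens.
Proof.
move=> sqf novar s s1 [le [mon_le lq]].
have [n0|[i0 _]] : n = 0%N \/ exists i : 'I_n, True.
- by case: n {gens sqf novar le mon_le lq} => [|k]; [left|right; exists ord0].
- exact: golod_no_variable.
have [gs gsE gslq] := exists_linear_quotient_seq sqf s1 mon_le lq.
apply: golod_of_linear_quotients gsE gslq _ => m /hasP[g ggens gm].
have Xin i : (g <= U_(i))%MM -> False.
  by move=> gi; apply: (novar i); apply/in_mon_idealX; exists g.
rewrite ltnNge; apply/negP; rewrite leq_eqVlt ltnS leqn0.
case/orP=> [/mdeg1P[i /eqP mi]|]; first by apply: (Xin i); rewrite -mi.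
(* If 1 were in I, then I would contain the variable of index [i0], which exists as n > 0. *)
rewrite mdeg_eq0 => /eqP m0; apply: (Xin i0); apply: lepm_trans gm _.
by rewrite m0; apply/mnm_lepP => x; rewrite mnm0E.
Qed.
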